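(* Let $0<q<1$ and $a'>0$. The $q$-Charlier polynomials $C_n(x;a';q)$, $n=0,1,2,\dots$, correspond to an indeterminate moment problem, and the orthogonality measure for them given by $$\sum_{m=0}^\infty\frac{{a'}^m q^{m(m-1)/2}}{(q;q)_m}\,C_n(q^{-m};a';q)\,C_{n'}(q^{-m};a';q)=(-a';q)_\infty\,q^{-n}\,(-q/a';q)_n\,(q;q)_n\,\delta_{nn'}$$ (that is, the measure with mass ${a'}^m q^{m(m-1)/2}/(q;q)_m$ at the point $q^{-m}$, $m=0,1,2,\dots$) is not extremal.
   Context: Notation: $(x;q)_k=\prod_{j=0}^{k-1}(1-xq^j)$, $(x;q)_\infty=\prod_{j\ge0}(1-xq^j)$. $q$-Charlier polynomials: $C_n(x;a';q)={}_2\phi_1(q^{-n},x;\,0;\,q,-q^{n+1}/a')=\sum_{k=0}^n\frac{(q^{-n};q)_k(x;q)_k}{(q;q)_k}\left(-\frac{q^{n+1}}{a'}\right)^k$, a polynomial of degree $n$ in $x$. A family of polynomials corresponds to an indeterminate (Hamburger) moment problem if it is orthogonal with respect to more than one normalized positive measure on $\mathbb R$. In the indeterminate case an orthogonality measure $\mu$ is called extremal if it comes from a constant (possibly infinite) parameter in the Nevanlinna parametrization; equivalently (M. Riesz), if the polynomials are complete in $L^2(\mu)$. *)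

(* Defs.v *)
From HB Require Import structures.
From mathcomp Require Import all_boot all_order all_algebra.
From mathcomp Require Import all_classical all_reals all_analysis.
From mathcomp Require Import complex.
Set Implicit Arguments.
Unset Strict Implicit.
Unset Printing Implicit Defensive.
Import Order.TTheory GRing.Theory Num.Theory.
Import numFieldNormedType.Exports.
Local Open Scope classical_set_scope.
Local Open Scope ring_scope.

(* (x; q)_k, over any ring: x is a number or the indeterminate of {poly R}. *)
Definition qpoch (A : pzRingType) (x q : A) (k : nat) : A :=
  \prod_(j < k) (1 - x * q ^+ j).

Definition qpoch_inf (R : realType) (x q : R) : R := limn (qpoch x q).

(* C_n(x; a; q), as a polynomial in x. *)
Definition qcharlier (R : realType) (a q : R) (n : nat) : {poly R} :=
  \sum_(k < n.+1)
    (qpoch (q ^- n) q k / qpoch q q k * (- (q ^+ n.+1 / a)) ^+ k)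
      *: qpoch 'X q%:P k.

Section MomentProblem.
Variable R : realType.
Implicit Types (p : nat -> {poly R}) (z : R[i]).
Implicit Types mu : {measure set (measurableTypeR R) -> \bar R}.

(* The polynomials p form an orthogonal system (p n being of degree n) for the
   positive measure mu, all of whose moments are finite. *)
Definition orthogonal_for p mu : Prop :=
  [/\ forall n, size (p n) = n.+1,
      forall k, mu.-integrable setT (fun x => (x ^+ k)%:E),
      forall n m, n != m -> \int[mu]_x ((p n).[x] * (p m).[x]) = 0
    & forall n, 0 < \int[mu]_x ((p n).[x] ^+ 2)].

Definition indeterminate p : Prop :=
  exists mu nu : probability (measurableTypeR R) R,
    [/\ orthogonal_for p mu, orthogonal_for p nu
      & exists2 A, measurable A & mu A <> nu A].

(* The Nevanlinna parametrization, for mu of total mass 1. *)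

Definition orthonormal mu p (n : nat) : {poly R} :=
  (Num.sqrt (\int[mu]_x ((p n).[x] ^+ 2)))^-1 *: p n.

(* Polynomial of the second kind, z |-> \int (P(z) - P(t)) / (z - t) dmu(t);
   the quotient is a polynomial in z, integrated coefficientwise. *)
Definition second_kind mu (P : {poly R}) : {poly R} :=
  \poly_(j < size P)
     \int[mu]_t (((P - P.[t]%:P) %/ ('X - t%:P)) `_ j).

Definition ceval (P : {poly R}) z : R[i] := (map_poly (real_complex R) P).[z].

Definition csum (u : nat -> R[i]) : R[i] :=
  limn (series (u : nat -> (R[i] : numFieldType))).

(* z * \sum_k f_k(0) g_k(z) *)
Definition kernel0 (f g : nat -> {poly R}) z : R[i] :=
  z * csum (fun k => ceval (f k) 0 * ceval (g k) z).

Section NevanlinnaMatrix.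
Variables (mu : {measure set (measurableTypeR R) -> \bar R}).
Variable p : nat -> {poly R}.
Let P := orthonormal mu p.
Let Q k := second_kind mu (P k).
Definition nevanlinnaA z : R[i] := kernel0 Q Q z.
Definition nevanlinnaB z : R[i] := -1 + kernel0 Q P z.
Definition nevanlinnaC z : R[i] := 1 + kernel0 P Q z.
Definition nevanlinnaD z : R[i] := kernel0 P P z.
End NevanlinnaMatrix.

Definition stieltjes mu z : R[i] :=
  Complex (\int[mu]_x complex.Re ((real_complex R x - z)^-1))
          (\int[mu]_x complex.Im ((real_complex R x - z)^-1)).

(* mu has Nevanlinna parameter phi, where None stands for the constant oo. *)
Definition nevanlinna_param mu p (phi : option (R[i] -> R[i])) : Prop :=
  forall z, complex.Im z != 0 ->
    stieltjes mu z =
      if phi is Some f then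
        - ((nevanlinnaA mu p z * f z - nevanlinnaC mu p z)
           / (nevanlinnaB mu p z * f z - nevanlinnaD mu p z))
      else - (nevanlinnaA mu p z / nevanlinnaB mu p z).

(* A parameter satisfies phi(z^* ) = (phi z)^* on C \ R, so its constant
   finite values are real. *)
Definition extremal p (mu : probability (measurableTypeR R) R) : Prop :=
  nevanlinna_param mu p None \/
  exists t : R, nevanlinna_param mu p (Some (fun=> real_complex R t)).

End MomentProblem.

Definition qcharlier_weight (R : realType) (a q : R) (m : nat) : R :=
  a ^+ m * q ^+ 'C(m, 2) / qpoch q q m.

Lemma qcharlier_weight_ge0 (R : realType) (a q : R) (m : nat) :
  0 < q < 1 -> 0 < a -> 0 <= qcharlier_weight a q m.
Proof.
move=> /andP[q0 q1] a0; rewrite divr_ge0 ?mulr_ge0 ?exprn_ge0 ?(ltW q0) ?(ltW a0)//.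
apply: prodr_ge0 => j _.
by rewrite subr_ge0 -exprS exprn_ile1 ?ltW.
Qed.

Definition qcharlier_measure (R : realType) (a q : R)
    (hq : 0 < q < 1) (ha : 0 < a) :
    {measure set (measurableTypeR R) -> \bar R} :=
  mseries (fun m => mscale (NngNum (qcharlier_weight_ge0 m hq ha))
                           (dirac (q ^- m : measurableTypeR R))) 0.

(* Main.v *)
Require Import Defs.
From mathcomp Require Import all_boot all_order all_algebra.
From mathcomp Require Import all_classical all_reals all_analysis.
From mathcomp Require Import measurable_realfun complex ring lra zify.
Import Order.TTheory GRing.Theory Num.Theory.
Import numFieldNormedType.Exports.
Local Open Scope classical_set_scope.
Local Open Scope ring_scope.

(** Write w_m = a^m q^(m choose 2) / (q; q)_m for the mass at q^-m, and E for the
    entire function E(z) = sum_m (-z)^m q^(m choose 2) / (q; q)_m.  The functional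
    equation E(z) = (1 - z) E(q z) gives E(z) = (z; q)_oo, hence the moments
    sum_m w_m q^(-m j) = E(- a q^-j), and the vanishing E(q^-k) = 0 for k >= 0.

    Orthogonality.  The weights satisfy a q-difference equation ([qsum_shift]):
    replacing g(x) by (1 - x) g(q x) multiplies the integral by - a / q.
    Iterating it evaluates the integral of (x; q)_k x^j, and the terminating
    q-binomial theorem then gives that of C_n x^j as a multiple of
    (q^-j; q)_n, which is 0 for j < n ([qsum_qcharlier_expr],
    [qsum_orthogonal]).

    Indeterminacy.  Let r = sqrt q.  The masses (-1)^n r^(n choose 2) / (r; r)_n at
    the points r^-n have all moments equal to 0, because E (for the base r)
    vanishes at r^-k.  At the points r^-2m = q^-m they are dominated by w_m, so a
    small multiple, with the sign making the masses at the odd powers of 1/r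
    positive, can be added to the measure.  This is a second solution
    ([qcharlier_indeterminate]).

    Non-extremality.  Let P_k be the orthonormal polynomials, Q_k those of the
    second kind, W_m the normalized masses and S the Stieltjes transform.
    Then Q_k(z) + S(z) P_k(z) is the integral of P_k(x) / (x - z)
    ([rsumE]).  If the parameter were the constant t, put s = 1; if it were oo,
    put s = 0 and t = 1.  In both cases, with v_k = t Q_k(0) - s P_k(0), the
    parametrization says that z times the sum over k of the integrals of
    v_k P_k(x) / (x - z) is s + t S(z) ([nevanlinna_combination]).  Equivalently,
    for the partial sums u_N of the series of v_k P_k, the masses
    W_m (q^-m u_N(q^-m) - t) have a Stieltjes transform that tends to 0
    ([resolvent_combination]), and then so does each of these masses
    ([cvg_masses]).  So u_N(x) tends to t / x on the support, in a sense strong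
    enough to integrate against functions of geometric growth in m
    ([cvg_integrals]).  But the function equal to (- 1/a)^m at q^-m is orthogonal
    to all polynomials, again because E vanishes at the points q^-k, while its
    integral against 1/x is a nonzero multiple of E(q) = (q; q)_oo.  Hence
    t = 0; and integrating the constant 1 gives s = 0, a contradiction
    ([combination_trivial]).  The estimates are easy because P_k(z) and
    Q_k(0) decrease geometrically. *)

Set Implicit Arguments.
Unset Strict Implicit.
Unset Printing Implicit Defensive.

(** * Absolutely convergent and rapidly decreasing real sequences *)

(** Sum of a series, meaningful when the series converges. *)
Definition tsum (R : realType) (u : nat -> R) : R := limn (series u).

(** Absolute convergence of the series of terms [u n]. *)
Definition abscv (R : realType) (u : nat -> R) : Prop :=
  cvgn (series (fun n => `|u n|)).

(** Faster decrease than every geometric sequence. *)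
Definition rapid (R : realType) (u : nat -> R) : Prop :=
  forall y : R, 0 <= y -> exists C : R, forall n, `|u n| * y ^+ n <= C.

Section Sums.
Variable R : realType.
Implicit Types u v : nat -> R.

Lemma abscv_cvg u : abscv u -> series u @ \oo --> tsum u.
Proof. by move=> cu; apply: (@normed_cvg R R^o). Qed.

Lemma tsum_eq u l : series u @ \oo --> l -> tsum u = l.
Proof. by move=> h; apply: cvg_lim. Qed.

Lemma abscv_le u v : (forall n, `|u n| <= v n) -> abscv v -> abscv u.
Proof.
move=> uv cv; apply: series_le_cvg cv => // n.
exact: le_trans (uv n) (ler_norm _).
Qed.

Lemma abscv_abs u : abscv u -> abscv (fun n => `|u n|).
Proof.
by move=> cu; rewrite /abscv (funext (fun n => normr_id (u n))).
Qed.

Lemma abscvZ c u : abscv u -> abscv (fun n => c * u n).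
Proof.
move=> cu; rewrite /abscv (funext (fun n => normrM c (u n))).
rewrite (_ : series _ = fun n => `|c| * series (fun n => `|u n|) n).
  exact: is_cvgMl_tmp.
by apply/funext => n; rewrite /series /= mulr_sumr.
Qed.

Lemma abscvD u v : abscv u -> abscv v -> abscv (fun n => u n + v n).
Proof.
move=> cu cv; apply: (@abscv_le _ (fun n => `|u n| + `|v n|)).
  by move=> n; exact: ler_normD.
rewrite /abscv (funext (fun n => ger0_norm (addr_ge0 (normr_ge0 (u n)) (normr_ge0 (v n))))).
rewrite (_ : series _ =
    fun n => series (fun n => `|u n|) n + series (fun n => `|v n|) n).
  exact: is_cvgD.
by apply/funext => n; rewrite /series /= big_split.
Qed.

Lemma abscv_sum (I : Type) (s : seq I) (u : I -> nat -> R) :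
  (forall i, abscv (u i)) -> abscv (fun n => \sum_(i <- s) u i n).
Proof.
move=> cu; elim: s => [|i s IH].
  rewrite /abscv (_ : series _ = cst 0); first exact: is_cvg_cst.
  by apply/funext => n; rewrite /series /= big1// => m _; rewrite big_nil normr0.
by under eq_fun do rewrite big_cons; apply: abscvD.
Qed.

Lemma tsumZ c u : abscv u -> tsum (fun n => c * u n) = c * tsum u.
Proof.
move=> /abscv_cvg cu; apply: tsum_eq.
rewrite (_ : series _ = fun n => c * series u n); first exact: cvgMl_tmp.
by apply/funext => n; rewrite /series /= mulr_sumr.
Qed.

Lemma tsumD u v : abscv u -> abscv v ->
  tsum (fun n => u n + v n) = tsum u + tsum v.
Proof.
move=> /abscv_cvg cu /abscv_cvg cv; apply: tsum_eq.
rewrite (_ : series _ = fun n => series u n + series v n); first exact: cvgD.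
by apply/funext => n; rewrite /series /= big_split.
Qed.

Lemma tsumB u v : abscv u -> abscv v ->
  tsum (fun n => u n - v n) = tsum u - tsum v.
Proof.
move=> cu cv; rewrite -mulN1r -tsumZ// -tsumD//; last exact: abscvZ.
by congr tsum; apply/funext => n; rewrite mulN1r.
Qed.

Lemma tsum0 : tsum (fun=> 0 : R) = 0.
Proof.
apply: tsum_eq; rewrite (_ : series _ = cst 0); first exact: cvg_cst.
by apply/funext => n; rewrite /series /= big1.
Qed.

Lemma tsum_sum (I : Type) (s : seq I) (u : I -> nat -> R) :
  (forall i, abscv (u i)) ->
  tsum (fun n => \sum_(i <- s) u i n) = \sum_(i <- s) tsum (u i).
Proof.
move=> cu; elim: s => [|i s IH].
  by rewrite big_nil; under eq_fun do rewrite big_nil; exact: tsum0.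
rewrite big_cons -IH -tsumD//; last exact: abscv_sum.
by under eq_fun do rewrite big_cons.
Qed.

Lemma le_tsum u v : abscv u -> abscv v -> (forall n, u n <= v n) ->
  tsum u <= tsum v.
Proof.
move=> /abscv_cvg cu /abscv_cvg cv uv.
exact: lim_series_le (cvgP _ cu) (cvgP _ cv) uv.
Qed.

Lemma tsum_ge0 u : abscv u -> (forall n, 0 <= u n) -> 0 <= tsum u.
Proof.
move=> cu u0; rewrite -tsum0; apply: le_tsum => //.
by apply: abscv_le cu => n; rewrite normr0.
Qed.

Lemma ler_norm_tsum u v : (forall n, `|u n| <= v n) -> abscv v ->
  `|tsum u| <= tsum v.
Proof.
move=> uv cv; have cu := abscv_le uv cv.
have h n : u n <= v n /\ - v n <= u n.
  by have := uv n; rewrite ler_norml => /andP[].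
rewrite ler_norml le_tsum// ?andbT; last by move=> n; case: (h n).
rewrite -mulN1r -tsumZ// le_tsum//; first exact: abscvZ.
by move=> n; rewrite mulN1r; case: (h n).
Qed.

Lemma abscv_shift u : abscv u -> abscv (fun n => u n.+1).
Proof.
move=> cu; rewrite /abscv.
have -> : series (fun n => `|u n.+1|) =
    fun n => series (fun n => `|u n|) n.+1 - `|u 0|.
  apply/funext => n; rewrite /series /= big_nat_recl// addrAC subrr add0r.
  by [].
apply: is_cvgB; last exact: is_cvg_cst.
apply/cvg_ex; exists (limn (series (fun n => `|u n|))); rewrite (cvg_shiftS (series (fun n => `|u n|))); exact: cu.
Qed.

Lemma tsumS u : abscv u -> tsum u = u 0%N + tsum (fun n => u n.+1).
Proof.
move=> cu; have /abscv_cvg cu' := abscv_shift cu.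
apply: tsum_eq; rewrite -(cvg_shiftS (series u)) /=.
rewrite (_ : (fun n => _) = fun n => u 0%N + series (fun n => u n.+1) n).
  by apply: cvgD => //; exact: cvg_cst.
by apply/funext => n; rewrite /series /= big_nat_recl.
Qed.

Lemma cvg_tsum_delta (c : R) (m : nat) :
  series (fun n : nat => if n == m then c else 0 : R) @ \oo --> c.
Proof.
apply: cvg_near_cst; near=> N; apply/eqP; rewrite /series /=.
rewrite (bigD1_seq m) ?iota_uniq//= ?mem_index_iota.
  by rewrite eqxx big1 ?addr0// => i /negPf ->.
by near: N; exact: nbhs_infty_gt.
Unshelve. all: by end_near. Qed.

Lemma abscv_delta (c : R) (m : nat) : abscv (fun n : nat => if n == m then c else 0).
Proof.
rewrite /abscv (_ : (fun n => _) = fun n : nat => if n == m then `|c| else 0).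
  exact: cvgP _ (@cvg_tsum_delta `|c| m).
by apply/funext => n; case: ifP; rewrite ?normr0.
Qed.

Lemma tsumD1 u (m : nat) : abscv u ->
  tsum u = u m + tsum (fun n : nat => if n == m then 0 else u n).
Proof.
move=> cu.
have cu' : abscv (fun n : nat => if n == m then 0 else u n).
  by apply: abscv_le (abscv_abs cu) => n; case: ifP; rewrite ?normr0.
rewrite -(tsum_eq (@cvg_tsum_delta (u m) m)) -tsumD//; last exact: abscv_delta.
congr tsum; apply/funext => n; case: eqP => [->|_]; first by rewrite addr0.
by rewrite add0r.
Qed.

Lemma ler_tsum_term u m : abscv u -> (forall n, 0 <= u n) -> u m <= tsum u.
Proof.
move=> cu u0; rewrite (tsumD1 m cu) lerDl tsum_ge0//.
  by apply: abscv_le (abscv_abs cu) => n; case: ifP; rewrite ?normr0.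
by move=> n; case: ifP.
Qed.

Lemma ler_series_tsum u n : abscv u -> (forall n, 0 <= u n) ->
  series u n <= tsum u.
Proof.
move=> /abscv_cvg cu u0; apply: (nondecreasing_cvgn_le _ (cvgP _ cu)).
exact: nondecreasing_series.
Qed.

Lemma abscv_geometric (C y : R) : 0 <= y < 1 -> abscv (fun n => C * y ^+ n).
Proof.
move=> /andP[y0 y1]; rewrite /abscv.
rewrite (_ : (fun n => _) = geometric `|C| y); last first.
  by apply/funext => n /=; rewrite normrM normrX (ger0_norm y0).
by apply: (@is_cvg_geometric_series R `|C| y); rewrite ger0_norm.
Qed.

(** ** Rapidly decreasing sequences *)

Lemma rapid_abscv u : rapid u -> abscv u.
Proof.
move=> /(_ 2 (ler0n _ _))[C hC].
apply: (@abscv_le _ (fun n => C * (2^-1) ^+ n)).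
  by move=> n; rewrite exprVn ler_pdivlMr ?exprn_gt0.
by apply: abscv_geometric; rewrite invr_ge0 ler0n invf_lt1 ?ltr1n.
Qed.

Lemma rapid_le u v : (forall n, `|u n| <= `|v n|) -> rapid v -> rapid u.
Proof.
move=> uv rv y y0; have [C hC] := rv y y0; exists C => n.
by apply: le_trans (hC n); rewrite ler_wpM2r ?exprn_ge0.
Qed.

Lemma rapid_ext u v : (forall n, u n = v n) -> rapid v -> rapid u.
Proof. by move=> uv; apply: rapid_le => n; rewrite uv. Qed.

Lemma rapidD u v : rapid u -> rapid v -> rapid (fun n => u n + v n).
Proof.
move=> ru rv y y0; have [C hC] := ru y y0; have [D hD] := rv y y0.
exists (C + D) => n; apply: le_trans (lerD (hC n) (hD n)).
by rewrite -mulrDl ler_wpM2r ?exprn_ge0 ?ler_normD.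
Qed.

(** A factor of at most geometric growth does not matter. *)
Lemma rapidM u v (K z : R) : (forall n, `|v n| <= K * z ^+ n) -> 0 <= z ->
  rapid u -> rapid (fun n => u n * v n).
Proof.
move=> hv z0 ru y y0; have [C hC] := ru (z * y) (mulr_ge0 z0 y0).
exists (`|K| * C) => n; rewrite normrM.
apply: (@le_trans _ _ (`|K| * (`|u n| * (z * y) ^+ n))); last first.
  by rewrite ler_wpM2l.
rewrite exprMn !mulrA ler_wpM2r ?exprn_ge0// [`|K| * _]mulrC -mulrA.
rewrite ler_wpM2l//; apply: le_trans (hv n) _.
by rewrite ler_wpM2r ?exprn_ge0 ?ler_norm.
Qed.

Lemma rapid_expr u (z : R) : rapid u -> rapid (fun n => u n * z ^+ n).
Proof. by apply: (@rapidM _ _ 1 `|z|) => // n; rewrite mul1r normrX. Qed.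

Lemma rapidZ u c : rapid u -> rapid (fun n => c * u n).
Proof.
move=> ru; under eq_fun do rewrite mulrC.
by apply: (@rapidM _ _ `|c| 1) => // n; rewrite expr1n mulr1.
Qed.

Lemma rapid_sum (I : Type) (s : seq I) (u : I -> nat -> R) :
  (forall i, rapid (u i)) -> rapid (fun n => \sum_(i <- s) u i n).
Proof.
move=> cu; elim: s => [|i s IH].
  by move=> y y0; exists 0 => n; rewrite big_nil normr0 mul0r.
by under eq_fun do rewrite big_cons; apply: rapidD.
Qed.

End Sums.

(** * The entire function [euler q z] equal to the infinite product (z; q)_oo *)

Section QPochhammer.
Variable R : comNzRingType.
Implicit Types x q : R.

Lemma qpoch0 x q : qpoch x q 0 = 1.
Proof. by rewrite /qpoch big_ord0. Qed.

Lemma qpochS x q k : qpoch x q k.+1 = qpoch x q k * (1 - x * q ^+ k).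
Proof. by rewrite /qpoch big_ord_recr. Qed.

Lemma qpochSl x q k : qpoch x q k.+1 = (1 - x) * qpoch (x * q) q k.
Proof.
rewrite /qpoch big_ord_recl expr0 mulr1; congr (_ * _).
by apply: eq_bigr => i _; rewrite exprS mulrA.
Qed.

End QPochhammer.

Lemma binS2 m : 'C(m.+1, 2) = ('C(m, 2) + m)%N.
Proof. by rewrite binS bin1. Qed.

(** Terms of Euler's expansion of (z; q)_oo in powers of z. *)
Definition eterm (R : realType) (q z : R) (m : nat) : R :=
  (- z) ^+ m * q ^+ 'C(m, 2) / qpoch q q m.

(** Sum of Euler's expansion; it equals the infinite product (z; q)_oo. *)
Definition euler (R : realType) (q z : R) : R := tsum (eterm q z).

Section Euler.
Variables (R : realType) (q : R).
Hypothesis hq : 0 < q < 1.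
Implicit Types y z : R.

Let q0 : 0 < q. Proof. by case/andP: hq. Qed.
Let q1 : q < 1. Proof. by case/andP: hq. Qed.

Lemma qexp_le1 m : q ^+ m <= 1.
Proof. by rewrite exprn_ile1 ?ltW. Qed.

Lemma qpoch_qq_gt0 m : 0 < qpoch q q m.
Proof.
apply: prodr_gt0 => j _; rewrite subr_gt0 -exprS exprn_ilt1 ?ltW//.
Qed.

Lemma qpoch_qq_ge m : (1 - q) ^+ m <= qpoch q q m.
Proof.
elim: m => [|m IH]; first by rewrite qpoch0 expr0.
rewrite qpochS exprSr ler_pM ?exprn_ge0 ?subr_ge0 ?(ltW q1)// lerD2l lerN2.
by rewrite ler_piMr ?qexp_le1 ?ltW.
Qed.

Lemma rapid_gauss : rapid (fun m => q ^+ 'C(m, 2)).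
Proof.
move=> y y0; pose t m := y ^+ m * q ^+ 'C(m, 2).
have t0 m : 0 <= t m by rewrite mulr_ge0 ?exprn_ge0 ?(ltW q0).
have tS m : t m.+1 = (y * q ^+ m) * t m by rewrite /t binS2 exprD exprS; ring.
have [M hM] : exists M, forall m, (M <= m)%N -> y * q ^+ m <= 1.
  have : (fun m => y * q ^+ m) @ \oo --> (y * 0 : R).
    by apply: cvgMl_tmp; apply: cvg_expr; rewrite ger0_norm// ltW.
  rewrite mulr0 => /cvgrPdist_le /(_ 1 ltr01)[M _ hM]; exists M => m Mm.
  have /= := hM m Mm; rewrite sub0r normrN ger0_norm//.
  by rewrite mulr_ge0 ?exprn_ge0 ?(ltW q0).
exists (\sum_(i < M.+1) t i) => m.
rewrite ger0_norm ?exprn_ge0 ?(ltW q0)// mulrC -/(t m).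
have small k : (k <= M)%N -> t k <= \sum_(i < M.+1) t i.
  move=> kM; rewrite (bigD1 (Ordinal (kM : (k < M.+1)%N)))//= lerDl.
  exact: sumr_ge0.
have [/small//|/ltnW Mm] := leqP m M.
apply: le_trans (small M (leqnn M)).
rewrite -(subnK Mm); elim: (m - M)%N => [//|d IH].
rewrite addSn tS; apply: le_trans IH.
by rewrite ler_piMl// hM// leq_addl.
Qed.

Lemma eterm0 z : eterm q z 0 = 1.
Proof. by rewrite /eterm expr0 qpoch0 divr1 mul1r expr0. Qed.

Lemma eterm_scale z y m : eterm q (z * y) m = eterm q z m * y ^+ m.
Proof. by rewrite /eterm -mulNr exprMn; ring. Qed.

Lemma rapid_eterm z : rapid (eterm q z).
Proof.
apply: (@rapid_le _ _ (fun m => q ^+ 'C(m, 2) * (`|z| / (1 - q)) ^+ m)).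
  move=> m; rewrite /eterm 3!normrM normrX normrN mulrAC -mulrA mulrC.
  rewrite !normrX !normrM normfV normr_id.
  rewrite [_^-1 * _]mulrC -mulrA ler_wpM2l ?exprn_ge0// mulrC exprMn.
  rewrite ler_wpM2l ?exprn_ge0// (gtr0_norm (qpoch_qq_gt0 m)) normfV.
  rewrite (@gtr0_norm _ (1 - q)) ?subr_gt0// exprVn.
  rewrite lef_pV2 ?posrE ?qpoch_qq_gt0 ?exprn_gt0 ?subr_gt0//.
  exact: qpoch_qq_ge.
exact: rapid_expr rapid_gauss.
Qed.

Lemma abscv_eterm z : abscv (eterm q z).
Proof. exact: rapid_abscv (rapid_eterm z). Qed.

(** The q-difference equation, from which the product expansion and the zeros
    follow. *)
Lemma eulerS z : euler q z = (1 - z) * euler q (z * q).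
Proof.
suff h : euler q z - euler q (z * q) = - z * euler q (z * q) by lra.
have cB : abscv (fun m => eterm q z m - eterm q (z * q) m).
  apply: rapid_abscv; under eq_fun do rewrite -mulN1r.
  by apply: rapidD (rapid_eterm _) _; apply: rapidZ; exact: rapid_eterm.
rewrite /euler -tsumB; [|exact: abscv_eterm..].
rewrite -tsumZ; last exact: abscv_eterm.
rewrite tsumS// !eterm0 subrr add0r; congr tsum; apply/funext => m.
rewrite !eterm_scale /eterm qpochS binS2 exprD.
have := gt_eqF (qpoch_qq_gt0 m.+1); rewrite qpochS => /negbT.
rewrite mulf_eq0 negb_or => /andP[].
rewrite !exprS; move: (qpoch q q m) (q ^+ m) ((- z) ^+ m) => p X Y h1 h2.
by field; rewrite h1.
Qed.

Lemma eulerN z N : euler q z = qpoch z q N * euler q (z * q ^+ N).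
Proof.
elim: N => [|N IH]; first by rewrite qpoch0 expr0 mulr1 mul1r.
by rewrite IH eulerS qpochS exprSr !mulrA.
Qed.

Lemma euler_pole k : euler q (q ^- k) = 0.
Proof.
elim: k => [|k IH]; first by rewrite expr0 invr1 eulerS subrr mul0r.
rewrite eulerS [_ * q](_ : _ = q ^- k); first by rewrite IH mulr0.
by rewrite exprS invfM mulrAC mulVf ?gt_eqF// mul1r.
Qed.

Lemma cvg_euler1 z : (fun N => euler q (z * q ^+ N)) @ \oo --> (1 : R).
Proof.
have cz := abscv_shift (@abscv_eterm z).
have cz' := abscv_abs cz.
apply/cvgrPdist_le => e e0.
have h N : `|1 - euler q (z * q ^+ N)| <=
    q ^+ N * tsum (fun m => `|eterm q z m.+1|).
  rewrite /euler tsumS; last exact: abscv_eterm.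
  rewrite eterm0 opprD addrA subrr add0r normrN -tsumZ//.
  apply: ler_norm_tsum; last exact: abscvZ.
  move=> m; rewrite eterm_scale normrM mulrC ler_wpM2r//.
  rewrite ger0_norm -exprM ?exprn_ge0 ?(ltW q0)// mulnS exprD.
  by rewrite ler_piMr ?exprn_ge0 ?qexp_le1 ?(ltW q0).
set K := tsum _ in h.
have : (fun N => q ^+ N * K) @ \oo --> (0 * K : R).
  by apply: cvgMr_tmp; apply: cvg_expr; rewrite ger0_norm// ltW.
rewrite mul0r => /cvgrPdist_le /(_ e e0); apply: filterS => N.
rewrite sub0r normrN => hN.
exact: le_trans (h N) (le_trans (ler_norm _) hN).
Qed.

Lemma cvg_qpoch z : qpoch z q @ \oo --> euler q z.
Proof.
have hE := @cvg_euler1 z.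
have hV : (fun N => (euler q (z * q ^+ N))^-1) @ \oo --> (1 : R).
  by rewrite -[X in _ --> X]invr1; apply: cvgV => //; exact: oner_neq0.
have : (fun N => euler q z / euler q (z * q ^+ N)) @ \oo --> euler q z.
  by rewrite -[X in _ --> X]mulr1; exact: cvgMl_tmp.
apply: cvg_trans; apply: near_eq_cvg.
have := hE; move=> /cvgr_neq0 /(_ (oner_neq0 _)); apply: filterS => N hN.
by rewrite (eulerN z N) mulfK.
Qed.

Lemma qpoch_infE z : qpoch_inf z q = euler q z.
Proof. by apply: cvg_lim; last exact: cvg_qpoch. Qed.

Lemma euler_ge1 y : 0 <= y -> 1 <= euler q (- y).
Proof.
move=> y0; rewrite -(eterm0 (- y)); apply: ler_tsum_term (@abscv_eterm _) _.
move=> m; rewrite /eterm opprK divr_ge0 ?(ltW (qpoch_qq_gt0 _))//.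
by rewrite mulr_ge0 ?exprn_ge0 ?(ltW q0).
Qed.

Lemma qpochN_ge1 y k : 0 <= y -> 1 <= qpoch (- y) q k.
Proof.
move=> y0; elim: k => [|k IH]; first by rewrite qpoch0.
rewrite qpochS mulNr opprK; apply: (le_trans IH); rewrite ler_peMr//; first exact: le_trans IH.
by rewrite lerDl mulr_ge0 ?exprn_ge0 ?(ltW q0).
Qed.

Lemma qpochN_le y k : 0 <= y -> qpoch (- y) q k <= euler q (- y).
Proof.
move=> y0; rewrite (eulerN (- y) k) ler_peMr//.
  exact: le_trans (qpochN_ge1 k y0).
by rewrite mulNr euler_ge1// mulr_ge0 ?exprn_ge0 ?(ltW q0).
Qed.

Lemma euler_le_qpoch k : euler q q <= qpoch q q k.
Proof.
rewrite -(@cvg_lim _ _ _ _ _ _ _ (@cvg_qpoch q))//.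
apply: nonincreasing_cvgn_ge; last exact: cvgP (@cvg_qpoch q).
apply/nonincreasing_seqP => m; rewrite qpochS ler_piMr ?(ltW (qpoch_qq_gt0 _))//.
by rewrite gerBl mulr_ge0 ?exprn_ge0 ?(ltW q0).
Qed.

Lemma euler_q_gt0 : 0 < euler q q.
Proof.
have ge0 : 0 <= euler q q.
  rewrite -(@cvg_lim _ _ _ _ _ _ _ (@cvg_qpoch q))//.
  apply: limr_ge; first exact: cvgP (@cvg_qpoch q).
  by near=> N; exact: ltW (qpoch_qq_gt0 N).
rewrite lt0r ge0 andbT; apply/negP => /eqP E0.
have := @cvg_euler1 q.
rewrite (_ : (fun N => _) = cst 0); last first.
  apply/funext => N /=; apply/eqP; have := eulerN q N; rewrite E0 => /esym/eqP.
  by rewrite mulf_eq0 gt_eqF ?qpoch_qq_gt0.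
move=> /(cvg_lim (@Rhausdorff R)); rewrite lim_cst// => /esym/eqP.
by rewrite oner_eq0.
Unshelve. all: by end_near. Qed.

End Euler.

(** * Moments and orthogonality of the q-Charlier polynomials *)

Section FiniteIdentities.
Variables (R : realType) (q : R).
Hypothesis hq : 0 < q < 1.

Let q0 : 0 < q. Proof. by case/andP: hq. Qed.
Let qn0 : q != 0. Proof. by rewrite gt_eqF. Qed.

Lemma qpoch_qVn n : qpoch (q ^- n) q n.+1 = 0.
Proof. by rewrite qpochS mulVf ?expf_neq0// subrr mulr0. Qed.

Lemma qpoch_qVn_vanish i n : (i < n)%N -> qpoch (q ^- i) q n = 0.
Proof.
move=> lt_in; rewrite /qpoch (bigD1 (Ordinal lt_in))//= mulVf ?expf_neq0//.
by rewrite subrr mul0r.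
Qed.

(** The terminating q-binomial theorem. *)
Lemma qbinomial n (z : R) :
  \sum_(k < n.+1) qpoch (q ^- n) q k / qpoch q q k * z ^+ k
  = qpoch (z * q ^- n) q n.
Proof.
elim: n z => [|n IH] z.
  by rewrite big_ord_recl big_ord0 !qpoch0 expr0 divr1 mulr1 addr0.
pose f n k := qpoch (q ^- n) q k / qpoch q q k : R.
have fS k : f n.+1 k.+1 = f n k.+1 - q ^- n.+1 * f n k.
  have h1 := gt_eqF (qpoch_qq_gt0 hq k.+1).
  rewrite /f qpochSl -[q ^- n.+1 * q](_ : q ^- n = _); last first.
    by rewrite exprS invfM mulrAC mulVf// mul1r.
  move: h1; rewrite !qpochS => /negbT; rewrite mulf_eq0 negb_or => /andP[].
  have : q ^+ n != 0 by rewrite expf_neq0.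
  rewrite exprS; move: (qpoch (q ^- n) q k) (qpoch q q k) (q ^+ n) (q ^+ k).
  by move=> A p X Y hX hp hY; field; rewrite qn0 hX hp hY.
rewrite big_ord_recl.
under eq_bigr do rewrite lift0 -/(f _ _) fS mulrBl exprS.
rewrite big_split /= sumrN addrA.
have -> : qpoch (q ^- n.+1) q 0 / qpoch q q 0 * z ^+ 0
    + \sum_(i < n.+1) f n i.+1 * (z * z ^+ i) = qpoch (z * q ^- n) q n.
  rewrite -IH; transitivity (\sum_(k < n.+2) f n k * z ^+ k).
    rewrite [RHS]big_ord_recl /f !qpoch0; congr (_ + _).
    by apply: eq_bigr => i _; rewrite -exprS.
  by rewrite big_ord_recr /= /f qpoch_qVn !mul0r addr0.
rewrite qpochSl -mulrA [q ^- n.+1 * q](_ : _ = q ^- n); last first.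
  by rewrite exprS invfM mulrAC mulVf// mul1r.
rewrite mulrBl mul1r; congr (_ - _); rewrite -IH mulr_sumr.
by apply: eq_bigr => i _; rewrite /f; ring.
Qed.

Lemma qpoch_qVnE n :
  qpoch (q ^- n) q n = (-1) ^+ n * q ^- 'C(n.+1, 2) * qpoch q q n.
Proof.
elim: n => [|n IH]; first by rewrite !qpoch0 !expr0 invr1 !mulr1.
rewrite qpochSl [q ^- n.+1 * q](_ : _ = q ^- n); last first.
  by rewrite exprS invfM mulrAC mulVf// mul1r.
rewrite IH qpochS (binS2 n.+1) exprD -exprS.
have : q ^+ 'C(n.+1, 2) != 0 by rewrite expf_neq0.
have : q ^+ n.+1 != 0 by rewrite expf_neq0.
rewrite [(-1) ^+ n.+1]exprS.
by move: (q ^+ n.+1) (q ^+ 'C(_, 2)) => X Y hX hY; field; rewrite hX hY.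
Qed.

Lemma qpoch_aVnE n (a : R) : a != 0 ->
  qpoch (- a * q ^- n) q n = a ^+ n * q ^- 'C(n.+1, 2) * qpoch (- (q / a)) q n.
Proof.
move=> a0; elim: n => [|n IH]; first by rewrite !qpoch0 !expr0 invr1 !mulr1.
rewrite qpochSl -(mulrA (- a)) [q ^- n.+1 * q](_ : _ = q ^- n); last first.
  by rewrite exprS invfM mulrAC mulVf// mul1r.
rewrite IH qpochS (binS2 n.+1) exprD (exprS a).
have -> : 1 - - (q / a) * q ^+ n = 1 + q ^+ n.+1 / a by rewrite exprS; ring.
have : q ^+ 'C(n.+1, 2) != 0 by rewrite expf_neq0.
have : q ^+ n.+1 != 0 by rewrite expf_neq0.
by move: (q ^+ n.+1) (q ^+ 'C(_, 2)) => X Y hX hY; field; rewrite hX hY a0.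
Qed.

Lemma horner_qpochX k (x : R) : (qpoch 'X q%:P k).[x] = qpoch x q k.
Proof.
rewrite /qpoch horner_prod; apply: eq_bigr => i _.
by rewrite -polyC_exp !hornerE.
Qed.

Lemma size_qpochX k : (size (qpoch ('X : {poly R}) q%:P k) <= k.+1)%N.
Proof.
elim: k => [|k IH]; first by rewrite qpoch0 size_poly1.
rewrite qpochS; apply: leq_trans (size_polyMleq _ _) _.
have h : (size (1 - 'X * q%:P ^+ k : {poly R})%R <= 2)%N.
  rewrite -polyC_exp (leq_trans (size_polyD _ _))// geq_max size_poly1 size_polyN.
  by rewrite mulrC mul_polyC (leq_trans (size_scale_leq _ _))// size_polyX.
by rewrite -subn1 leq_subLR (leq_trans (leq_add IH h))// addn2.
Qed.

Lemma coef_qpochX k :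
  (qpoch ('X : {poly R}) q%:P k)`_k = (-1) ^+ k * q ^+ 'C(k, 2).
Proof.
elim: k => [|k IH]; first by rewrite qpoch0 coef1 !expr0 mulr1.
rewrite qpochS mulrBr mulr1 coefB nth_default ?size_qpochX// sub0r.
rewrite mulrA -polyC_exp coefMC coefMX /= IH binS2 exprD exprS.
by ring.
Qed.

End FiniteIdentities.

Section QCharlier.
Variables (R : realType) (q a : R).
Hypothesis hq : 0 < q < 1.
Hypothesis ha : 0 < a.

Let q0 : 0 < q. Proof. by case/andP: hq. Qed.
Let qn0 : q != 0. Proof. by rewrite gt_eqF. Qed.
Let an0 : a != 0. Proof. by rewrite gt_eqF. Qed.

Local Notation w := (qcharlier_weight a q).
Local Notation C := (qcharlier a q).
Local Notation M := (euler q (- a)).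

Lemma qcharlier_weightE m : w m = eterm q (- a) m.
Proof. by rewrite /eterm opprK. Qed.

Lemma qcharlier_weight_gt0 m : 0 < w m.
Proof. by rewrite divr_gt0 ?mulr_gt0 ?exprn_gt0 ?qpoch_qq_gt0. Qed.

Lemma qcharlier_weightS m :
  w m.+1 * (1 - q ^+ m.+1) = a * q ^+ m * w m.
Proof.
rewrite /qcharlier_weight qpochS binS2 exprD -(exprS q) (exprS a).
have := gt_eqF (qpoch_qq_gt0 hq m.+1); rewrite qpochS -exprS => /negbT.
rewrite mulf_eq0 negb_or => /andP[].
by move: (qpoch q q m) (1 - q ^+ m.+1) => p X hp hX; field; rewrite hp hX.
Qed.

Lemma mass_gt0 : 0 < M.
Proof. by apply: lt_le_trans ltr01 _; rewrite euler_ge1// ltW. Qed.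

Lemma horner_qcharlier n x : (C n).[x] = \sum_(k < n.+1)
  (qpoch (q ^- n) q k / qpoch q q k * (- (q ^+ n.+1 / a)) ^+ k) * qpoch x q k.
Proof.
rewrite /qcharlier horner_sum; apply: eq_bigr => k _.
by rewrite hornerZ horner_qpochX.
Qed.

(** The sum of [g] against the unnormalized q-Charlier weights. *)
Definition qsum (g : R -> R) : R := tsum (fun m => w m * g (q ^- m)).

(** The weighted values of [g] on the support decrease rapidly; then the product
    of [g] with any polynomial is summable. *)
Definition tame (g : R -> R) : Prop := rapid (fun m => w m * g (q ^- m)).

Lemma exprVAC m k : (q ^- m) ^+ k = (q ^- k) ^+ m.
Proof. by rewrite -!exprVn exprAC. Qed.

Lemma tame_ext g h : (forall x, g x = h x) -> tame h -> tame g.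
Proof. by move=> gh; apply: rapid_ext => m; rewrite gh. Qed.

Lemma tame_expr k : tame (fun x => x ^+ k).
Proof.
apply: rapid_ext (rapid_expr (q ^- k) (rapid_eterm hq (- a))) => m.
by rewrite qcharlier_weightE exprVAC.
Qed.

Lemma tameM_expr g k : tame g -> tame (fun x => g x * x ^+ k).
Proof.
move=> hg; apply: rapid_ext (rapid_expr (q ^- k) hg) => m.
by rewrite exprVAC mulrA.
Qed.

Lemma tameZ c g : tame g -> tame (fun x => c * g x).
Proof.
by move=> hg; apply: rapid_ext (rapidZ c hg) => m; rewrite mulrCA.
Qed.

Lemma tame_sum n (g : nat -> R -> R) : (forall k, tame (g k)) ->
  tame (fun x => \sum_(k < n) g k x).
Proof.
move=> hg; have := @rapid_sum R 'I_n (index_enum 'I_n) _ (fun i => hg i).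
by apply: rapid_ext => m; rewrite mulr_sumr.
Qed.

Lemma tameM_poly g (p : {poly R}) : tame g -> tame (fun x => g x * p.[x]).
Proof.
move=> hg; have h k : tame (fun x => p`_k * (g x * x ^+ k)).
  exact/tameZ/tameM_expr.
apply: tame_ext (tame_sum (size p) h) => x; rewrite horner_coef mulr_sumr.
by apply: eq_bigr => i _; rewrite mulrCA.
Qed.

Lemma tame_poly (p : {poly R}) : tame (fun x => p.[x]).
Proof.
by apply: tame_ext (tameM_poly p (tame_expr 0)) => x; rewrite expr0 mul1r.
Qed.

Lemma tame_inv : tame (fun x => x^-1).
Proof.
apply: rapid_ext (rapid_expr q (rapid_eterm hq (- a))) => m.
by rewrite qcharlier_weightE invrK.
Qed.

Lemma eq_qsum g h : (forall x, g x = h x) -> qsum g = qsum h.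
Proof. by move=> /funext ->. Qed.

Lemma qsumZ c g : tame g -> qsum (fun x => c * g x) = c * qsum g.
Proof.
move=> hg; rewrite /qsum -tsumZ; last exact: rapid_abscv.
by congr tsum; apply/funext => m; rewrite mulrCA.
Qed.

Lemma qsum_sum n (g : nat -> R -> R) : (forall k, tame (g k)) ->
  qsum (fun x => \sum_(k < n) g k x) = \sum_(k < n) qsum (g k).
Proof.
move=> hg; rewrite /qsum -tsum_sum; last by move=> k; exact/rapid_abscv/hg.
by congr tsum; apply/funext => m; rewrite mulr_sumr.
Qed.

(** The moments. *)
Lemma qsum_expr j : qsum (fun x => x ^+ j) = qpoch (- a * q ^- j) q j * M.
Proof.
rewrite /qsum.
transitivity (euler q (- a * q ^- j)).
  rewrite /euler; congr tsum; apply/funext => m.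
  by rewrite eterm_scale qcharlier_weightE exprVAC.
by rewrite (eulerN hq _ j) mulfVK ?expf_neq0.
Qed.

Lemma qsum_inv : qsum (fun x => x^-1) = M / (1 + a).
Proof.
have -> : qsum (fun x => x^-1) = euler q (- a * q).
  rewrite /qsum /euler; congr tsum; apply/funext => m.
  by rewrite eterm_scale qcharlier_weightE invrK.
by rewrite (eulerS hq (- a)) opprK mulrAC divff ?mul1r// gt_eqF// addr_gt0.
Qed.

(** The weights satisfy a first order q-difference equation, and the factor
    [1 - x] vanishes at the first point of the support. *)
Lemma qsum_shift g : tame g ->
  qsum (fun x => (1 - x) * g (q * x)) = - (a / q) * qsum g.
Proof.
move=> hg; rewrite /qsum -tsumZ; last exact: rapid_abscv.
have eqS m : w m.+1 * ((1 - q ^- m.+1) * g (q * q ^- m.+1))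
    = - (a / q) * (w m * g (q ^- m)).
  rewrite [q * q ^- m.+1](_ : _ = q ^- m); last first.
    by rewrite exprS invfM mulrA divff// mul1r.
  rewrite mulrA [RHS]mulrA; congr (_ * _).
  have hX : q ^+ m != 0 by rewrite expf_neq0.
  rewrite -[- (a / q) * w m](_ : - q ^- m.+1 * (a * q ^+ m * w m) = _).
    rewrite -qcharlier_weightS; move: (w m.+1) => W.
    by rewrite exprS; move: (q ^+ m) hX => X hX; field; rewrite qn0 hX.
  by rewrite exprS; move: (q ^+ m) hX => X hX; field; rewrite qn0 hX.
apply: tsum_eq; rewrite -(cvg_shiftS (series _)) /=.
rewrite (_ : (fun n => _) = series (fun m => - (a / q) * (w m * g (q ^- m)))).
  by apply: abscv_cvg; apply: abscvZ; exact: rapid_abscv.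
apply/funext => N; rewrite /series /= big_nat_recl//.
rewrite expr0 invr1 subrr mul0r mulr0 add0r.
by apply: eq_bigr => i _; exact: eqS.
Qed.

Lemma qsum_qpoch (psi : R -> R) (c : R) k : c != 0 -> tame psi ->
  (forall x, psi (q * x) = c * psi x) ->
  qsum (fun x => qpoch x q k * psi x) = (- (a / (q * c))) ^+ k * qsum psi.
Proof.
move=> c0 hpsi psiM; elim: k => [|k IH].
  by rewrite expr0 mul1r; apply: eq_qsum => x; rewrite qpoch0 mul1r.
have tk (p : {poly R}) : tame (fun x => p.[x] * psi x).
  by apply: tame_ext (tameM_poly p hpsi) => x; rewrite mulrC.
rewrite exprS -mulrA -IH.
have -> : - (a / (q * c)) = c^-1 * - (a / q) by rewrite invfM; ring.
rewrite -mulrA -qsum_shift; last first.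
  by apply: tame_ext (tk (qpoch 'X q%:P k)) => x; rewrite horner_qpochX.
rewrite -qsumZ.
  by apply: eq_qsum => x; rewrite psiM qpochSl (mulrC q); field.
pose P := (1%:P - 'X) * (qpoch 'X q%:P k \Po (q%:P * 'X)).
apply: tame_ext (tameZ c (tk P)) => x.
rewrite psiM /P hornerM horner_comp hornerM horner_qpochX hornerD hornerN.
by rewrite !hornerC hornerX; ring.
Qed.

(** The powers of [x], of exponent -1 included, are such functions [psi]. *)
Lemma qsum_qcharlier (psi : R -> R) (c : R) n : c != 0 -> tame psi ->
  (forall x, psi (q * x) = c * psi x) ->
  qsum (fun x => (C n).[x] * psi x) = qpoch c^-1 q n * qsum psi.
Proof.
move=> c0 hpsi psiM.
pose f k := qpoch (q ^- n) q k / qpoch q q k * (- (q ^+ n.+1 / a)) ^+ k.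
have tk k : tame (fun x => qpoch x q k * psi x).
  apply: tame_ext (tameM_poly (qpoch 'X q%:P k) hpsi) => x.
  by rewrite horner_qpochX mulrC.
transitivity (qsum (fun x => \sum_(k < n.+1) f k * (qpoch x q k * psi x))).
  apply: eq_qsum => x; rewrite horner_qcharlier mulr_suml.
  by apply: eq_bigr => k _; rewrite mulrA.
rewrite (@qsum_sum _ (fun k x => f k * (qpoch x q k * psi x))); last first.
  by move=> k; exact: tameZ.
have -> : qpoch c^-1 q n = qpoch ((q ^+ n / c) * q ^- n) q n.
  by rewrite mulrAC divff ?expf_neq0// mul1r.
rewrite -qbinomial// mulr_suml; apply: eq_bigr => k _.
rewrite qsumZ// (qsum_qpoch _ c0)// mulrA; congr (_ * _).
have -> : q ^+ n / c = - (q ^+ n.+1 / a) * - (a / (q * c)).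
  by rewrite exprS; field; rewrite an0 c0 qn0.
by rewrite /f exprMn mulrA.
Qed.

Lemma qcharlier_at0 n : (C n).[0] = qpoch (- (q / a)) q n.
Proof.
rewrite horner_qcharlier.
have -> : qpoch (- (q / a)) q n = qpoch (- (q ^+ n.+1 / a) * q ^- n) q n.
  by rewrite exprS; congr qpoch; field; rewrite an0 expf_neq0.
rewrite -qbinomial//; apply: eq_bigr => k _.
rewrite [qpoch 0 q k](_ : _ = 1) ?mulr1// /qpoch big1// => i _.
by rewrite mul0r subr0.
Qed.

Lemma qsum_qcharlier_inv n :
  qsum (fun x => (C n).[x] * x^-1) = qpoch q q n * (M / (1 + a)).
Proof.
rewrite (@qsum_qcharlier _ q^-1) ?invr_eq0//.
- by rewrite invrK qsum_inv.
- exact: tame_inv.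
- by move=> x; rewrite invfM.
Qed.

Lemma qsum_qcharlier_expr n j :
  qsum (fun x => (C n).[x] * x ^+ j)
  = qpoch (q ^- j) q n * (qpoch (- a * q ^- j) q j * M).
Proof.
rewrite (@qsum_qcharlier _ (q ^+ j)) ?expf_neq0//.
- by rewrite qsum_expr.
- exact: tame_expr.
- by move=> x; rewrite exprMn.
Qed.

Lemma size_qcharlier_le n : (size (C n) <= n.+1)%N.
Proof.
rewrite /qcharlier; apply: leq_trans (size_sum _ _ _) _.
apply/bigmax_leqP => k _; apply: leq_trans (size_scale_leq _ _) _.
by apply: leq_trans (size_qpochX q k) _; exact: ltn_ord.
Qed.

Lemma coef_qcharlier n : (C n)`_n = qpoch (q ^- n) q n / qpoch q q n
  * (- (q ^+ n.+1 / a)) ^+ n * ((-1) ^+ n * q ^+ 'C(n, 2)).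
Proof.
rewrite /qcharlier coef_sum big_ord_recr big1 /= ?add0r.
  by rewrite coefZ coef_qpochX.
by move=> k _; rewrite coefZ nth_default ?mulr0// (leq_trans (size_qpochX q k)).
Qed.

(** Squared norm of [C n] for the normalized measure. *)
Definition qnorm2 n := q ^- n * qpoch (- (q / a)) q n * qpoch q q n.

Lemma qnorm2_gt0 n : 0 < qnorm2 n.
Proof.
rewrite !mulr_gt0 ?invr_gt0 ?exprn_gt0 ?qpoch_qq_gt0//.
by apply: lt_le_trans ltr01 _; rewrite qpochN_ge1// divr_ge0 ?ltW.
Qed.

Lemma qnorm2E n : (C n)`_n * qpoch (q ^- n) q n * qpoch (- a * q ^- n) q n
  = qnorm2 n.
Proof.
rewrite coef_qcharlier qpoch_aVnE// qpoch_qVnE// /qnorm2.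
have hT : ('C(n.+1, 2) = 'C(n, 2) + n)%N by rewrite binS2.
have hn : q ^+ n.+1 ^+ n = q ^+ 'C(n, 2) ^+ 2 * q ^+ n ^+ 2.
  rewrite -!exprM -exprD; congr (_ ^+ _).
  have := mul_bin_diag n.+1 1; rewrite bin1 hT; lia.
rewrite hT exprD -mulNr exprMn -[in (- q ^+ n.+1) ^+ n]mulN1r exprMn hn exprVn.
have := gt_eqF (qpoch_qq_gt0 hq n) => /negbT.
have : q ^+ 'C(n, 2) != 0 by rewrite expf_neq0.
have : q ^+ n != 0 by rewrite expf_neq0.
have : a ^+ n != 0 by rewrite expf_neq0.
have : (-1) ^+ n * (-1) ^+ n = 1 :> R by rewrite -expr2 sqrr_sign.
move: (qpoch q q n) (qpoch (- (q / a)) q n) ((-1) ^+ n : R) (q ^+ 'C(n, 2)) (q ^+ n) (a ^+ n).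
move=> p r s T X A hs hA hX hT' hp.
transitivity ((s * s) * (s * s) * (X^-1 * r * p)).
  by field; rewrite hA hX hT' hp.
by rewrite hs !mul1r.
Qed.

Lemma size_qcharlier n : size (C n) = n.+1.
Proof.
apply/eqP; rewrite eqn_leq size_qcharlier_le /= ltnNge; apply/negP => h.
have := qnorm2_gt0 n; rewrite -qnorm2E nth_default// !mul0r.
by rewrite ltxx.
Qed.

Lemma qsum_poly (g : R -> R) (p : {poly R}) : tame g ->
  qsum (fun x => g x * p.[x]) = \sum_(i < size p) p`_i * qsum (fun x => g x * x ^+ i).
Proof.
move=> hg.
transitivity (qsum (fun x => \sum_(i < size p) p`_i * (g x * x ^+ i))).
  apply: eq_qsum => x; rewrite horner_coef mulr_sumr.
  by apply: eq_bigr => i _; rewrite mulrCA.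
rewrite (@qsum_sum _ (fun i x => p`_i * (g x * x ^+ i))).
  by apply: eq_bigr => i _; rewrite -qsumZ//; exact: tameM_expr.
by move=> k; exact/tameZ/tameM_expr.
Qed.

Lemma qsum_orthogonal n m :
  qsum (fun x => (C n).[x] * (C m).[x]) = M * qnorm2 n * (n == m)%:R.
Proof.
wlog le_mn : n m / (m <= n)%N => [hw|].
  have [/hw//|/ltnW/hw] := leqP m n.
  under eq_qsum do rewrite mulrC; move=> ->; rewrite eq_sym.
  by case: eqP => [->|]//; rewrite !mulr0.
rewrite qsum_poly ?size_qcharlier; last exact: tame_poly.
rewrite big_ord_recr big1 /= ?add0r; last first.
  move=> i _; rewrite qsum_qcharlier_expr qpoch_qVn_vanish ?mul0r ?mulr0//.
  exact: leq_trans le_mn.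
rewrite qsum_qcharlier_expr; case: eqP => [<-|/eqP ne].
  by rewrite mulr1 -qnorm2E; ring.
rewrite qpoch_qVn_vanish ?mul0r ?mulr0//.
by rewrite ltn_neqAle eq_sym ne.
Qed.

End QCharlier.

(** * Discrete measures on the line *)

(** The measure of mass [v m] at the point [x m]. *)
Definition dmeasure (R : realType) (v : nat -> {nonneg R}) (x : nat -> R) :
    {measure set (measurableTypeR R) -> \bar R} :=
  mseries (fun m => mscale (v m) (dirac (x m : measurableTypeR R))) 0.

(** Integration against [mu] is summation with the weights [u m] at the
    points [x m]. *)
Definition sums_at (R : realType) (mu : {measure set (measurableTypeR R) -> \bar R})
    (u x : nat -> R) : Prop :=
  [/\ forall m, 0 <= u m, abscv u &
  forall g : R -> R, measurable_fun setT g -> (forall y, 0 <= g y) ->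
    abscv (fun m => u m * g (x m)) ->
    (\int[mu]_y (g y)%:E = (tsum (fun m => u m * g (x m)))%:E)%E].

Section Discrete.
Variable R : realType.
Implicit Types (v : nat -> {nonneg R}) (u x : nat -> R) (f g : R -> R).
Implicit Types mu : {measure set (measurableTypeR R) -> \bar R}.

Lemma eseries_tsum u : abscv u ->
  (\sum_(m <oo) (u m)%:E)%E = (tsum u)%:E.
Proof.
move=> /abscv_cvg cu; apply: cvg_lim => //.
rewrite (_ : (fun n => _) = EFin \o series u); first by apply: cvg_EFin => //; exact: nearW.
by apply/funext => n; rewrite /= /series /= -sumEFin.
Qed.

Lemma dmeasure_sums_at v x : abscv (fun m => (v m)%:num) ->
  sums_at (dmeasure v x) (fun m => (v m)%:num) x.
Proof.
move=> cv; split => // g mg g0 cg.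
have mg' : measurable_fun setT (EFin \o g) by exact/measurable_EFinP.
rewrite ge0_integral_measure_series//; last by move=> y _; rewrite lee_fin.
rewrite -eseries_tsum//; apply: eq_eseriesr => m _.
rewrite ge0_integral_mscale//; last by move=> y _; rewrite lee_fin.
by rewrite integral_dirac// diracT mul1e.
Qed.

Lemma sums_at_setT mu u x : sums_at mu u x -> mu setT = (tsum u)%:E.
Proof.
move=> [_ cu h].
have e : (fun m => u m * cst 1 (x m)) = u by apply/funext => m; rewrite /= mulr1.
have := h (cst 1) (measurable_cst _) (fun=> ler01); rewrite e => /(_ cu) <-.
by rewrite -[LHS]mul1e -integral_cst.
Qed.

Lemma mnormalize_sums_at mu (P : probability (measurableTypeR R) R) u x :
  sums_at mu u x -> 0 < tsum u ->
  sums_at (mnormalize mu P) (fun m => (tsum u)^-1 * u m) x.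
Proof.
move=> hmu M0; have muT := sums_at_setT hmu; case: hmu => u0 cu h.
split => [m||g mg g0 cg]; first by rewrite mulr_ge0// invr_ge0 ltW.
  exact: abscvZ.
have M0' : 0 <= (tsum u)^-1 by rewrite invr_ge0 ltW.
rewrite (@eq_measure_integral _ _ _ _ (mscale (NngNum M0') mu)); last first.
  move=> A mA _.
  transitivity ((if (mu setT == 0) || (mu setT == +oo) then P A
    else mu A * (fine (mu setT))^-1%:E))%E.
    by rewrite /= /mnormalize; case: ifP.
  by rewrite muT eqe gt_eqF//= /mscale/= muleC.
have cg' : abscv (fun m => u m * g (x m)).
  have := @abscvZ R (tsum u) _ cg; rewrite (_ : (fun n => _) = fun m => u m * g (x m))//.
  by apply/funext => m; rewrite -mulrA mulVKf// gt_eqF.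
rewrite ge0_integral_mscale//; first last.
- by move=> y _; rewrite lee_fin.
- exact/measurable_EFinP.
rewrite h//= -EFinM -tsumZ//; congr (tsum _)%:E.
by apply/funext => m; rewrite mulrA.
Qed.

Section Integral.
Variables (mu : {measure set (measurableTypeR R) -> \bar R}) (u x : nat -> R).
Hypothesis hmu : sums_at mu u x.

Let u0 m : 0 <= u m. Proof. by case: hmu. Qed.

Lemma abscv_weighted_le f g : (forall y, `|g y| <= `|f y|) ->
  abscv (fun m => u m * f (x m)) -> abscv (fun m => u m * g (x m)).
Proof.
move=> gf /abscv_abs; apply: abscv_le => m.
by rewrite !normrM ler_wpM2l.
Qed.

Lemma sums_at_integrable f : measurable_fun setT f ->
  abscv (fun m => u m * f (x m)) -> mu.-integrable setT (EFin \o f).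
Proof.
move=> mf cf; case: hmu => _ _ h; apply/integrableP; split.
  exact/measurable_EFinP.
have -> : (\int[mu]_y `|(EFin \o f) y| = \int[mu]_y (Num.norm (f y))%:E)%E by [].
rewrite (h (fun y => `|f y|)) ?ltry//.
- exact: measurableT_comp.
- by apply: (@abscv_weighted_le f (fun y => `|f y|)) => // y; rewrite normr_id.
Qed.

Lemma sums_at_Rintegral f : measurable_fun setT f ->
  abscv (fun m => u m * f (x m)) ->
  \int[mu]_y f y = tsum (fun m => u m * f (x m)).
Proof.
move=> mf cf; case: hmu => _ _ h.
have cp : abscv (fun m => u m * f^\+ (x m)).
  apply: (@abscv_weighted_le f f^\+) => // y.
  by rewrite ger0_norm ?funrpos_ge0// -[`|f y|]/((Num.norm \o f) y)
     -funrposDneg lerDl funrneg_ge0.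
have cn : abscv (fun m => u m * f^\- (x m)).
  apply: (@abscv_weighted_le f f^\-) => // y.
  by rewrite ger0_norm ?funrneg_ge0// -[`|f y|]/((Num.norm \o f) y)
     -funrposDneg lerDr funrpos_ge0.
rewrite /Rintegral integralE funerpos funerneg.
rewrite (h f^\+ (measurable_funrpos mf) (funrpos_ge0 _) cp).
rewrite (h f^\- (measurable_funrneg mf) (funrneg_ge0 _) cn).
rewrite -EFinB /= -tsumB//; congr tsum; apply/funext => m.
rewrite -mulrBr; congr (_ * _).
by rewrite -[in RHS](funrposBneg f).
Qed.

End Integral.
End Discrete.

(** A measure whose moments are proportional to those of the q-Charlier weights
    is an orthogonality measure. *)
Section OrthogonalFor.
Variables (R : realType) (q a : R).
Hypotheses (hq : 0 < q < 1) (ha : 0 < a).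
Variables (mu : {measure set (measurableTypeR R) -> \bar R}) (u x : nat -> R).
Hypothesis hmu : sums_at mu u x.
Variable K : R.
Hypothesis K0 : 0 < K.
Hypothesis cux : forall k, abscv (fun m => u m * x m ^+ k).
Hypothesis moments :
  forall k, tsum (fun m => u m * x m ^+ k) = K * qsum q a (fun y => y ^+ k).

Let cuxp (p : {poly R}) i : abscv (fun m => p`_i * (u m * x m ^+ i)).
Proof. exact: abscvZ. Qed.

Lemma sums_at_abscv_poly (p : {poly R}) : abscv (fun m => u m * p.[x m]).
Proof.
have := @abscv_sum R 'I_(size p) (index_enum _) _ (fun i => @cuxp p i).
rewrite (_ : (fun m => _) = fun m => u m * p.[x m])//.
apply/funext => m; rewrite horner_coef mulr_sumr.
by apply: eq_bigr => i _; rewrite mulrCA.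
Qed.

Lemma sums_at_poly (p : {poly R}) :
  tsum (fun m => u m * p.[x m]) = K * qsum q a (fun y => p.[y]).
Proof.
transitivity (tsum (fun m => \sum_(i < size p) p`_i * (u m * x m ^+ i))).
  congr tsum; apply/funext => m; rewrite horner_coef mulr_sumr.
  by apply: eq_bigr => i _; rewrite mulrCA.
rewrite (@tsum_sum R 'I_(size p) _ (fun i m => p`_i * (u m * x m ^+ i)))//.
have -> : qsum q a (fun y => p.[y]) =
    \sum_(i < size p) p`_i * qsum q a (fun y => y ^+ i).
  transitivity (qsum q a (fun y => y ^+ 0 * p.[y])).
    by apply: eq_qsum => y; rewrite mul1r.
  rewrite qsum_poly; last exact: tame_expr.
  apply: eq_bigr => i _; congr (_ * _).
  by apply: eq_qsum => y; rewrite mul1r.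
rewrite mulr_sumr; apply: eq_bigr => i _.
by rewrite tsumZ// moments mulrCA.
Qed.

Lemma sums_at_Rintegral_poly (p : {poly R}) :
  \int[mu]_y p.[y] = K * qsum q a (fun y => p.[y]).
Proof.
rewrite (sums_at_Rintegral hmu); first exact: sums_at_poly.
- exact: measurable_poly.
- exact: sums_at_abscv_poly.
Qed.

Lemma sums_at_Rintegral_qcharlier n m :
  \int[mu]_y ((qcharlier a q n).[y] * (qcharlier a q m).[y])
  = K * (euler q (- a) * qnorm2 q a n * (n == m)%:R).
Proof.
rewrite -qsum_orthogonal//.
under eq_Rintegral do rewrite -hornerM.
rewrite sums_at_Rintegral_poly; congr (_ * _).
by apply: eq_qsum => y; rewrite hornerM.
Qed.

Lemma sums_at_orthogonal_for : orthogonal_for (qcharlier a q) mu.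
Proof.
split.
- exact: size_qcharlier.
- by move=> k; apply: (sums_at_integrable hmu (f := fun y => y ^+ k)).
- by move=> n m ne; rewrite sums_at_Rintegral_qcharlier (negPf ne) !mulr0.
- move=> n; under eq_Rintegral do rewrite expr2.
  rewrite sums_at_Rintegral_qcharlier eqxx mulr1 mulr_gt0// mulr_gt0//.
    exact: mass_gt0.
  exact: qnorm2_gt0.
Qed.

End OrthogonalFor.

(** * The moment problem is indeterminate *)

(** Sequences supported by the even integers *)
Section EvenSupport.
Variable R : realType.
Implicit Types g : nat -> R.

Lemma series_even g n :
  series (fun n => if odd n then 0 else g n./2) n = series g (uphalf n).
Proof.
elim: n => [|n IH]; first by rewrite /series /= !big_geq.
rewrite /series /= big_nat_recr//=.
move: IH; rewrite /series /= => ->; case: ifPn => on.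
  by rewrite addr0 uphalf_half on.
by rewrite uphalf_half (negPf on) add0n big_nat_recr.
Qed.

Lemma cvg_series_even g (l : R) : series g @ \oo --> l ->
  series (fun n => if odd n then 0 else g n./2) @ \oo --> l.
Proof.
move=> cg; rewrite (_ : series _ = series g \o uphalf).
  apply: cvg_comp cg; apply/cvgnyPge => A; near=> n.
  rewrite uphalf_half; apply: leq_trans (leq_addl _ _).
  rewrite -(doubleK A); apply: half_leq.
  by near: n; exact: nbhs_infty_ge.
by apply/funext => n; exact: series_even.
Unshelve. all: by end_near. Qed.

Lemma abscv_even g : abscv g -> abscv (fun n => if odd n then 0 else g n./2).
Proof.
move=> /cvg_ex[l cg]; apply/cvg_ex; exists l.
rewrite (_ : (fun n => _) = fun n => if odd n then 0 else `|g n./2|).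
  exact: (@cvg_series_even (fun m => `|g m|)).
by apply/funext => n; case: ifP; rewrite ?normr0.
Qed.

Lemma tsum_even g : abscv g ->
  tsum (fun n => if odd n then 0 else g n./2) = tsum g.
Proof. by move=> /abscv_cvg cg; apply: tsum_eq; exact: cvg_series_even. Qed.

End EvenSupport.

Section Charlier.
Variables (R : realType) (q a : R).
Hypotheses (hq : 0 < q < 1) (ha : 0 < a).

Let q0 : 0 < q. Proof. by case/andP: hq. Qed.
Let q1 : q < 1. Proof. by case/andP: hq. Qed.

Local Notation w := (qcharlier_weight a q).
Local Notation M := (euler q (- a)).
Local Notation muq := (qcharlier_measure hq ha).
Local Notation delta0 := (dirac (0 : measurableTypeR R) : probability (measurableTypeR R) R).

Lemma abscv_weight k : abscv (fun m => w m * (q ^- m) ^+ k).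
Proof. exact/rapid_abscv/tame_expr. Qed.

Lemma weight_moments0 : (fun m => w m * (q ^- m) ^+ 0) = w.
Proof. by apply/funext => m; rewrite mulr1. Qed.

Lemma tsum_weight : tsum w = M.
Proof.
have := qsum_expr a hq 0.
by rewrite /qsum weight_moments0 qpoch0 mul1r.
Qed.

Lemma qcharlier_measure_sums_at : sums_at muq w (fun m => q ^- m).
Proof.
apply: dmeasure_sums_at => /=.
by have := @abscv_weight 0; rewrite weight_moments0.
Qed.

Lemma sums_at_normalized_orthogonal_for
    (mu : {measure set (measurableTypeR R) -> \bar R}) u x :
  sums_at mu u x -> (forall k, abscv (fun m => u m * x m ^+ k)) ->
  (forall k, tsum (fun m => u m * x m ^+ k) = qsum q a (fun y => y ^+ k)) ->
  orthogonal_for (qcharlier a q) (mnormalize mu delta0).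
Proof.
move=> hmu cux mom.
have uM : tsum u = M.
  have := mom 0%N; rewrite qsum_expr// qpoch0 mul1r => <-.
  by congr tsum; apply/funext => m; rewrite mulr1.
have uM0 : 0 < tsum u by rewrite uM; exact: mass_gt0.
have h := mnormalize_sums_at delta0 hmu uM0.
apply: (sums_at_orthogonal_for hq ha h (K := (tsum u)^-1)).
- by rewrite invr_gt0.
- move=> k; have := @abscvZ R (tsum u)^-1 _ (cux k).
  rewrite (_ : (fun n => _) = fun m => (tsum u)^-1 * u m * x m ^+ k)//.
  by apply/funext => m; rewrite mulrA.
- move=> k; rewrite -mom -tsumZ//; congr tsum.
  by apply/funext => m; rewrite mulrA.
Qed.

Lemma sums_at_set (mu : {measure set (measurableTypeR R) -> \bar R}) u x
    (A : set (measurableTypeR R)) : sums_at mu u x -> measurable A ->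
  abscv (fun m => u m * \1_A (x m)) /\
  mu A = (tsum (fun m => u m * \1_A (x m)))%:E.
Proof.
move=> [u0 cu h] mA.
have cA : abscv (fun m => u m * \1_A (x m)).
  apply: abscv_le cu => m; rewrite indicE; case: (_ \in _).
    by rewrite mulr1 ger0_norm.
  by rewrite mulr0 normr0.
split=> //; rewrite -(h \1_A)//; first by rewrite integral_indic// setIT.
Qed.

Section SecondSolution.

Let r := Num.sqrt q.

Let hr : 0 < r < 1.
Proof. by rewrite sqrtr_gt0 q0 -sqrtr1 ltr_sqrt. Qed.

Let r0 : 0 < r. Proof. by case/andP: hr. Qed.

Let rr : r ^+ 2 = q. Proof. by rewrite sqr_sqrtr ?ltW. Qed.

(** Signed masses at the points r^-n. Their moments are the opposites of the
    products (r^-k; r)_oo = 0. *)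
Let e n := - eterm r 1 n.

Let eE n : e n = (-1) ^+ n.+1 * (r ^+ 'C(n, 2) / qpoch r r n).
Proof. by rewrite /e /eterm exprS; ring. Qed.

Let e_moment k : tsum (fun n => e n * (r ^- n) ^+ k) = 0.
Proof.
rewrite (_ : (fun n => _) = fun n => -1 * eterm r (r ^- k) n).
  rewrite tsumZ ?[tsum _](euler_pole hr k) ?mulr0//.
  exact: abscv_eterm.
apply/funext => n; rewrite /e -[r ^- k in RHS]mul1r eterm_scale -!exprVn exprAC.
by rewrite mulN1r mulNr.
Qed.

Let rapid_e : rapid e.
Proof.
apply: rapid_ext (rapidZ (-1) (rapid_eterm hr 1)) => n.
by rewrite mulN1r.
Qed.

(** The negative masses sit at the points of the given measure, where they are
    dominated by its weights. *)
Let dominated : exists2 B : R, 0 < B & forall m, - e m.*2 <= B * w m.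
Proof.
have [C hC] := rapid_gauss hq (divr_ge0 (ltW r0) (ltW ha)).
have C0 : 0 < C.
  by have := hC 0%N; rewrite !expr0 mulr1 normr1; exact: lt_le_trans.
exists (C / euler r r); first by rewrite divr_gt0 ?euler_q_gt0.
move=> m; rewrite eE -signr_odd /= odd_double expr1 mulN1r opprK -mul2n.
have -> : r ^+ 'C(2 * m, 2) = q ^+ 'C(m, 2) * (q ^+ 'C(m, 2) * r ^+ m).
  rewrite -rr -!exprM -!exprD; congr (_ ^+ _).
  elim: m => [//|m IH]; rewrite mulnS !binS2 IH; lia.
have hCm : q ^+ 'C(m, 2) * r ^+ m <= C * a ^+ m.
  have := hC m; rewrite ger0_norm ?exprn_ge0 ?(ltW q0)// exprMn exprVn mulrA.
  by rewrite ler_pdivrMr ?exprn_gt0.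
have wm : a ^+ m * q ^+ 'C(m, 2) <= w m.
  rewrite /qcharlier_weight ler_peMr ?mulr_ge0 ?exprn_ge0 ?(ltW ha) ?(ltW q0)//.
  rewrite invf_ge1 ?qpoch_qq_gt0//.
  elim: m {hCm} => [|m IH]; first by rewrite qpoch0.
  rewrite qpochS (le_trans _ IH)// ler_piMr ?(ltW (qpoch_qq_gt0 hq _))//.
  by rewrite gerBl mulr_ge0 ?exprn_ge0 ?(ltW q0).
have s1 : q ^+ 'C(m, 2) * (q ^+ 'C(m, 2) * r ^+ m) <= C * w m.
  apply: (@le_trans _ _ (C * (a ^+ m * q ^+ 'C(m, 2)))).
    by rewrite [leLHS]mulrC mulrA ler_wpM2r ?exprn_ge0 ?(ltW q0).
  by rewrite ler_wpM2l ?(ltW C0).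
apply: (@le_trans _ _ (C * w m / qpoch r r (2 * m))).
  by rewrite ler_wpM2r// invr_ge0 ltW ?qpoch_qq_gt0.
rewrite mulrAC ler_wpM2r// ?(ltW (qcharlier_weight_gt0 hq ha _))//.
rewrite ler_wpM2l ?(ltW C0)// lef_pV2 ?posrE ?qpoch_qq_gt0 ?euler_q_gt0//.
exact: euler_le_qpoch.
Qed.

Lemma qcharlier_indeterminate : indeterminate (qcharlier a q).
Proof.
have [B B0 hB] := dominated.
pose h n := if odd n then 0 else w n./2.
pose u n := h n + B^-1 * e n.
have u0 n : 0 <= u n.
  rewrite /u /h; case: ifPn => on.
    rewrite add0r mulr_ge0 ?invr_ge0 ?(ltW B0)// eE -signr_odd /= on expr0 mul1r.
    by rewrite divr_ge0 ?exprn_ge0 ?(ltW r0)// ltW ?qpoch_qq_gt0.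
  rewrite -[n in e n]odd_double_half (negPf on) add0n.
  have := hB n./2; rewrite -ler_pdivrMl// mulrN; lra.
have hk k n : h n * (r ^- n) ^+ k =
    if odd n then 0 else (fun m => w m * (q ^- m) ^+ k) n./2.
  rewrite /h; case: ifPn => on; first by rewrite mul0r.
  by rewrite -{2}[n]odd_double_half (negPf on) add0n -mul2n exprM rr.
have ch k : abscv (fun n => h n * (r ^- n) ^+ k).
  rewrite (funext (hk k)).
  exact: (@abscv_even _ _ (@abscv_weight k)).
have ce k : abscv (fun n => e n * (r ^- n) ^+ k).
  apply: rapid_abscv; apply: rapid_ext (rapid_expr (r ^- k) rapid_e) => n.
  by rewrite -!exprVn exprAC.
have uE k : (fun n => u n * (r ^- n) ^+ k) =
    fun n => h n * (r ^- n) ^+ k + B^-1 * (e n * (r ^- n) ^+ k).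
  by apply/funext => n; rewrite /u mulrDl mulrA.
have cu k : abscv (fun n => u n * (r ^- n) ^+ k).
  by rewrite uE; apply: abscvD => //; exact: abscvZ.
have mu_u k : tsum (fun n => u n * (r ^- n) ^+ k) = qsum q a (fun y => y ^+ k).
  rewrite uE tsumD//; last exact: abscvZ.
  rewrite tsumZ// e_moment mulr0 addr0 (funext (hk k)).
  by rewrite (tsum_even (@abscv_weight k)).
pose nu := dmeasure (fun n => NngNum (u0 n)) (fun n => r ^- n).
have hnu : sums_at nu u (fun n => r ^- n).
  apply: dmeasure_sums_at => /=; have := cu 0%N.
  by rewrite (_ : (fun n => _) = u)//; apply/funext => n; rewrite mulr1.
exists (mnormalize muq delta0), (mnormalize nu delta0); split.
- apply: sums_at_normalized_orthogonal_for qcharlier_measure_sums_at _ _ => //.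
  exact: abscv_weight.
- exact: sums_at_normalized_orthogonal_for hnu cu mu_u.
pose A : set (measurableTypeR R) := [set r ^- 1].
have mA : measurable A by exact: measurable_set1.
exists A => //.
have hw := qcharlier_measure_sums_at.
have Mw : 0 < tsum w by rewrite tsum_weight; exact: mass_gt0.
have Mu : 0 < tsum u.
  rewrite (_ : tsum u = M); first exact: mass_gt0.
  have := mu_u 0%N; rewrite qsum_expr// qpoch0 mul1r => <-.
  by congr tsum; apply/funext => m; rewrite mulr1.
have [_ ->] := sums_at_set (mnormalize_sums_at delta0 hw Mw) mA.
have [cA ->] := sums_at_set (mnormalize_sums_at delta0 hnu Mu) mA.
rewrite (_ : (fun m => _) = fun=> 0); last first.
  apply/funext => m; rewrite indicE memNset ?mulr0// /A /=.
  move=> /(congr1 GRing.inv); rewrite !invrK -rr -exprM => h1.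
  have := congr1 (fun y => y ^+ 1) h1.
  have r1 : r != 1 by rewrite lt_eqF//; case/andP: hr.
  have : (2 * m)%N != 1%N by lia.
  move=> ne _; have := @ieexprIn R r r0 r1 (2 * m)%N 1%N h1.
  by move=> /eqP; rewrite (negPf ne).
rewrite tsum0 => -[]/esym/eqP; rewrite gt_eqF//.
apply: (lt_le_trans _ (@ler_tsum_term R _ 1%N cA _)).
  rewrite indicE mem_set//= mulr1 mulr_gt0 ?invr_gt0//.
  rewrite /u /h /= add0r mulr_gt0 ?invr_gt0// eE /= -signr_odd /= expr0 mul1r.
  by rewrite divr_gt0 ?exprn_gt0 ?qpoch_qq_gt0.
move=> n; rewrite mulr_ge0 ?mulr_ge0 ?invr_ge0 ?(ltW Mu)//.
Qed.

End SecondSolution.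
End Charlier.

(** * Absolutely convergent complex series *)

Section ComplexSums.
Variable R : realType.
Implicit Types (z : R[i]) (u v : nat -> R[i]) (c : R).

Local Notation re := (@complex.Re R).
Local Notation im := (@complex.Im R).
Local Notation rc := (real_complex R).
Local Notation normc := (@Normc.normc R).

Lemma ReD z1 z2 : re (z1 + z2) = re z1 + re z2.
Proof. by case: z1 z2 => [? ?] [? ?]. Qed.

Lemma ImD z1 z2 : im (z1 + z2) = im z1 + im z2.
Proof. by case: z1 z2 => [? ?] [? ?]. Qed.

Lemma ReM z1 z2 : re (z1 * z2) = re z1 * re z2 - im z1 * im z2.
Proof. by case: z1 z2 => [? ?] [? ?]. Qed.

Lemma ImM z1 z2 : im (z1 * z2) = re z1 * im z2 + im z1 * re z2.
Proof. by case: z1 z2 => [? ?] [? ?]. Qed.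

Lemma ReZ c z : re (rc c * z) = c * re z.
Proof. by rewrite ReM /= mul0r subr0. Qed.

Lemma ImZ c z : im (rc c * z) = c * im z.
Proof. by rewrite ImM /= mul0r addr0. Qed.

Lemma normc_ge_re z : `|re z| <= normc z.
Proof.
by case: z => x y /=; rewrite -sqrtr_sqr ler_wsqrtr// lerDl sqr_ge0.
Qed.

Lemma normc_ge_im z : `|im z| <= normc z.
Proof.
by case: z => x y /=; rewrite -sqrtr_sqr ler_wsqrtr// lerDr sqr_ge0.
Qed.

Lemma normc_ge0 z : 0 <= normc z.
Proof. exact: le_trans (normc_ge_re z). Qed.

Lemma normcR c : normc (rc c) = `|c|.
Proof. by rewrite /= expr0n /= addr0 sqrtr_sqr. Qed.

Lemma normc_le z : normc z <= `|re z| + `|im z|.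
Proof.
case: z => x y /=.
rewrite -[leRHS]ger0_norm ?addr_ge0// -sqrtr_sqr ler_wsqrtr//.
rewrite sqrrD !real_normK ?num_real// lerD2r lerDl.
by rewrite mulrn_wge0// mulr_ge0.
Qed.

(** Componentwise sum of a complex series. *)
Definition ctsum u : R[i] := Complex (tsum (re \o u)) (tsum (im \o u)).

(** Absolute convergence of the two components. *)
Definition cabscv u : Prop := abscv (re \o u) /\ abscv (im \o u).

Lemma cabscv_le u (v : nat -> R) :
  (forall n, normc (u n) <= v n) -> abscv v -> cabscv u.
Proof.
move=> uv cv; split; apply: abscv_le cv => n /=.
  exact: le_trans (normc_ge_re _) (uv n).
exact: le_trans (normc_ge_im _) (uv n).
Qed.

Lemma cabscvD u v : cabscv u -> cabscv v -> cabscv (fun n => u n + v n).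
Proof.
move=> [ur ui] [vr vi]; split.
  rewrite (_ : _ \o _ = fun n => re (u n) + re (v n)); first exact: abscvD.
  by apply/funext => n /=; rewrite ReD.
rewrite (_ : _ \o _ = fun n => im (u n) + im (v n)); first exact: abscvD.
by apply/funext => n /=; rewrite ImD.
Qed.

Lemma ctsumD u v : cabscv u -> cabscv v ->
  ctsum (fun n => u n + v n) = ctsum u + ctsum v.
Proof.
move=> [ur ui] [vr vi]; apply/eqP; rewrite eq_complex ReD ImD /= -!tsumD//.
apply/andP; split; apply/eqP; congr tsum; apply/funext => n /=.
  by rewrite ReD.
by rewrite ImD.
Qed.

Lemma cabscvZ z u : cabscv u -> cabscv (fun n => z * u n).
Proof.
move=> [ur ui]; split.
  rewrite (_ : _ \o _ = fun n => re z * re (u n) + - im z * im (u n)).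
    by apply: abscvD; exact: abscvZ.
  by apply/funext => n /=; rewrite ReM mulNr.
rewrite (_ : _ \o _ = fun n => re z * im (u n) + im z * re (u n)).
  by apply: abscvD; exact: abscvZ.
by apply/funext => n /=; rewrite ImM.
Qed.

Lemma ctsumZ z u : cabscv u -> ctsum (fun n => z * u n) = z * ctsum u.
Proof.
move=> [ur ui]; apply/eqP; rewrite eq_complex; apply/andP; split; apply/eqP.
  rewrite ReM /= -!tsumZ// -tsumB; [|exact: abscvZ..].
  by congr tsum; apply/funext => n /=; rewrite ReM.
rewrite ImM /= -!tsumZ// -tsumD; [|exact: abscvZ..].
by congr tsum; apply/funext => n /=; rewrite ImM.
Qed.

Lemma ctsum_sum (I : Type) (s : seq I) (u : I -> nat -> R[i]) :
  (forall i, cabscv (u i)) ->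
  cabscv (fun n => \sum_(i <- s) u i n) /\
  ctsum (fun n => \sum_(i <- s) u i n) = \sum_(i <- s) ctsum (u i).
Proof.
move=> cu; elim: s => [|i s [IHc IH]].
  rewrite big_nil (_ : (fun n => _) = fun=> 0); last first.
    by apply/funext => n; rewrite big_nil.
  split; last by rewrite /ctsum /comp /= tsum0.
  apply: (@cabscv_le _ (fun n => 0 * 0 ^+ n)) => [n|].
    by rewrite normcR normr0 mul0r.
  by apply: abscv_geometric; rewrite lexx ltr01.
rewrite (_ : (fun n => _) = fun n => u i n + \sum_(j <- s) u j n); last first.
  by apply/funext => n; rewrite big_cons.
by split; [exact: cabscvD|rewrite big_cons ctsumD// IH].
Qed.

Lemma cvg_ctsum u : cabscv u ->
  series (u : nat -> (R[i] : numFieldType)) @ \oo --> (ctsum u : (R[i] : numFieldType)).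
Proof.
move=> [/abscv_cvg/cvgrPdist_lt hr /abscv_cvg/cvgrPdist_lt hi].
apply/cvgrPdist_lt => -[e1 e2]; rewrite ltcE /= => /andP[/eqP -> e0].
have e20 : 0 < e1 / 2 by rewrite divr_gt0.
near=> n.
have hn : normc (ctsum u - series (u : nat -> (R[i] : numFieldType)) n) < e1.
  apply: (le_lt_trans (normc_le _)); rewrite [ltRHS]splitr.
  have sre : re (series (u : nat -> (R[i] : numFieldType)) n) = series (re \o u) n.
    by rewrite /series /= (big_morph re ReD (erefl _)).
  have sim : im (series (u : nat -> (R[i] : numFieldType)) n) = series (im \o u) n.
    by rewrite /series /= (big_morph im ImD (erefl _)).
  have ReN z : re (- z) = - re z by case: z.
  have ImN z : im (- z) = - im z by case: z.
  rewrite ReD ImD ReN ImN sre sim; apply: ltrD.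
    by near: n; exact: hr.
  by near: n; exact: hi.
by rewrite -[X in _ < X]/(rc e1) ltcR.
Unshelve. all: by end_near. Qed.

Lemma csumE u : cabscv u -> csum u = ctsum u.
Proof. by move=> /cvg_ctsum cu; apply: (cvg_lim (@norm_hausdorff _ _) cu). Qed.

End ComplexSums.

(** * Resolvents and polynomials of the second kind *)

Section Ceval.
Variable R : realType.
Implicit Types (P : {poly R}) (z : R[i]).
Local Notation rc := (real_complex R).

Lemma ceval_wide P z n : (size P <= n)%N ->
  ceval P z = \sum_(j < n) rc P`_j * z ^+ j.
Proof.
move=> Pn; rewrite /ceval (@horner_coef_wide _ n) ?size_map_poly//.
by apply: eq_bigr => j _; rewrite coef_map.
Qed.

Lemma cevalR P (t : R) : ceval P (rc t) = rc P.[t].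
Proof. exact: horner_map. Qed.

Lemma cevalZ P (c : R) z : ceval (c *: P) z = rc c * ceval P z.
Proof. by rewrite /ceval map_polyZ hornerZ. Qed.

(** The divided difference (P - P(t)) / (X - t), a polynomial in X. *)
Definition ddiff P (t : R) : {poly R} := (P - P.[t]%:P) %/ ('X - t%:P).

Lemma ddiffE P t : P - P.[t]%:P = ddiff P t * ('X - t%:P).
Proof.
rewrite /ddiff divpK// dvdp_XsubCl /root !hornerE subrr//.
Qed.

Lemma ceval_ddiff P t z : ceval P z - rc P.[t] = ceval (ddiff P t) z * (z - rc t).
Proof.
have := congr1 (fun p => ceval p z) (ddiffE P t).
rewrite /ceval rmorphB rmorphM rmorphB /= map_polyX !map_polyC /=.
by rewrite !hornerE.
Qed.

Lemma size_ddiff P t : (size (ddiff P t) <= size P)%N.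
Proof.
apply: leq_trans (leq_divp _ _) _; apply: leq_trans (size_polyD _ _) _.
rewrite geq_max leqnn size_polyN size_polyC.
have [->|nP] := eqVneq P 0; first by rewrite horner0 eqxx.
by apply: leq_trans (leq_b1 _) _; rewrite size_poly_gt0.
Qed.

(** The coefficients of the divided difference are polynomials in [t]: by Horner's
    scheme, they satisfy a downward recursion. *)
Lemma coef_ddiff P j : exists c : {poly R}, forall t, (ddiff P t)`_j = c.[t].
Proof.
have [n Pn] : exists n, (size P <= j + n)%N by exists (size P); exact: leq_addl.
elim: n j Pn => [|n IH] j Pn.
  exists 0 => t; rewrite horner0 nth_default// (leq_trans (size_ddiff P t))//.
  by rewrite addn0 in Pn.
have [c hc] := IH j.+1 ltac:(by rewrite addSnnS).
exists ((P`_j.+1)%:P + 'X * c) => t; rewrite hornerD hornerC hornerM hornerX -hc.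
have := congr1 (fun p : {poly R} => p`_j.+1) (ddiffE P t).
rewrite coefB coefC /= subr0 => ->.
rewrite mulrBr coefB coefMX coefMC /=; ring.
Qed.

End Ceval.

Section Resolvent.
Variable R : realType.
Local Notation rc := (real_complex R).
Local Notation re := (@complex.Re R).
Local Notation im := (@complex.Im R).
Local Notation normc := (@Normc.normc R).
Implicit Types (x : R) (z : R[i]).

Lemma subRc_neq0 x z : im z != 0 -> rc x - z != 0.
Proof.
move=> z0; apply: contra z0 => /eqP/(congr1 im); rewrite ImD /=.
by case: z => ? y /= /eqP; rewrite add0r oppr_eq0.
Qed.

Lemma re_resolvent x z :
  re ((rc x - z)^-1) = (x - re z) / ((x - re z) ^+ 2 + im z ^+ 2).
Proof. by case: z => u v /=; rewrite add0r sqrrN. Qed.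

Lemma im_resolvent x z :
  im ((rc x - z)^-1) = im z / ((x - re z) ^+ 2 + im z ^+ 2).
Proof. by case: z => u v /=; rewrite add0r sqrrN mulNr opprK. Qed.

Lemma normc_resolvent x z : im z != 0 -> normc ((rc x - z)^-1) <= `|im z|^-1.
Proof.
move=> z0; rewrite Normc.normcV lef_pV2 ?posrE ?normr_gt0//; last first.
  rewrite lt0r normc_ge0 andbT; apply: contra (subRc_neq0 x z0).
  by move=> /eqP/Normc.eq0_normc ->.
apply: le_trans (normc_ge_im _).
by case: z {z0} => u v /=; rewrite add0r normrN.
Qed.

Lemma resolvent_den_gt0 x z : im z != 0 -> 0 < (x - re z) ^+ 2 + im z ^+ 2.
Proof.
move=> z0; apply: lt_le_trans (_ : 0 < im z ^+ 2) _.
  by rewrite lt0r sqrf_eq0 z0 sqr_ge0.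
by rewrite lerDr sqr_ge0.
Qed.

Lemma continuous_resolvent_den z : im z != 0 ->
  continuous (fun x => ((x - re z) ^+ 2 + im z ^+ 2)^-1).
Proof.
move=> z0 x; apply: cvgV; first by rewrite gt_eqF// resolvent_den_gt0.
apply: cvgD; last exact: cvg_cst.
by rewrite expr2; under eq_fun do rewrite expr2; apply: cvgM;
  apply: cvgB; (exact: cvg_id || exact: cvg_cst).
Qed.

Lemma measurable_re_resolvent z : im z != 0 ->
  measurable_fun setT (fun x => re ((rc x - z)^-1)).
Proof.
move=> z0; apply: continuous_measurable_fun => x.
under eq_fun do rewrite re_resolvent.
apply: cvgM; last exact: continuous_resolvent_den.
by apply: cvgB; [exact: cvg_id|exact: cvg_cst].
Qed.

Lemma measurable_im_resolvent z : im z != 0 ->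
  measurable_fun setT (fun x => im ((rc x - z)^-1)).
Proof.
move=> z0; apply: continuous_measurable_fun => x.
under eq_fun do rewrite im_resolvent.
by apply: cvgM; [exact: cvg_cst|exact: continuous_resolvent_den].
Qed.

End Resolvent.

Section SumsAt.
Variable R : realType.
Local Notation rc := (real_complex R).
Local Notation re := (@complex.Re R).
Local Notation im := (@complex.Im R).
Local Notation normc := (@Normc.normc R).
Variables (mu : {measure set (measurableTypeR R) -> \bar R}) (u x : nat -> R).
Hypothesis hmu : sums_at mu u x.
Hypothesis cux : forall p : {poly R}, abscv (fun m => u m * p.[x m]).
Implicit Types (z : R[i]) (P : {poly R}).

Lemma ctsum_rc (r : nat -> R) z : abscv r ->
  cabscv (fun m => rc (r m) * z) /\ ctsum (fun m => rc (r m) * z) = rc (tsum r) * z.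
Proof.
move=> cr.
have cc : cabscv (rc \o r).
  apply: (@cabscv_le _ _ (fun m => `|r m|)); last exact: abscv_abs.
  by move=> m; rewrite normcR.
rewrite (_ : (fun m => _) = fun m => z * (rc \o r) m); last first.
  by apply/funext => m; rewrite mulrC.
split; first exact: cabscvZ.
rewrite ctsumZ// mulrC; congr (_ * _); rewrite /ctsum.
rewrite [re \o _](_ : _ = r)//.
by rewrite [im \o _](_ : _ = fun=> 0)// tsum0.
Qed.

Lemma cabscv_bounded (r : nat -> R) (g : nat -> R[i]) K : abscv r ->
  (forall m, normc (g m) <= K) -> cabscv (fun m => rc (r m) * g m).
Proof.
move=> cr gK; apply: (@cabscv_le _ _ (fun m => K * `|r m|)).
  move=> m; rewrite Normc.normcM normcR mulrC.
  by rewrite ler_wpM2r.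
by apply: abscvZ; exact: abscv_abs.
Qed.

Let cu : abscv u. Proof. by case: hmu. Qed.

Lemma stieltjes_sums_at z : im z != 0 ->
  cabscv (fun m => rc (u m) * (rc (x m) - z)^-1) /\
  stieltjes mu z = ctsum (fun m => rc (u m) * (rc (x m) - z)^-1).
Proof.
move=> z0.
have cc : cabscv (fun m => rc (u m) * (rc (x m) - z)^-1).
  by apply: cabscv_bounded cu _ => m; exact: normc_resolvent.
split=> //; case: (cc) => cr ci.
have er : re \o (fun m => rc (u m) * (rc (x m) - z)^-1) =
    fun m => u m * re ((rc (x m) - z)^-1).
  by apply/funext => m; rewrite /= -ReZ.
have ei : im \o (fun m => rc (u m) * (rc (x m) - z)^-1) =
    fun m => u m * im ((rc (x m) - z)^-1).
  by apply/funext => m; rewrite /= -ImZ.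
rewrite /ctsum er ei; rewrite er in cr; rewrite ei in ci.
congr (Complex _ _).
  exact: (sums_at_Rintegral hmu (measurable_re_resolvent z0) cr).
exact: (sums_at_Rintegral hmu (measurable_im_resolvent z0) ci).
Qed.

Lemma ceval_second_kind P z : (forall m, rc (x m) != z) ->
  cabscv (fun m => rc (u m) * ((ceval P z - rc P.[x m]) / (z - rc (x m)))) /\
  ceval (second_kind mu P) z =
  ctsum (fun m => rc (u m) * ((ceval P z - rc P.[x m]) / (z - rc (x m)))).
Proof.
move=> xz.
rewrite (@ceval_wide _ (second_kind mu P) z (size P)) ?size_poly//.
pose f (j : 'I_(size P)) m := rc (u m * (ddiff P (x m))`_j) * z ^+ j.
have hf j : cabscv (f j) /\
    ctsum (f j) = rc (\int[mu]_t (ddiff P t)`_j) * z ^+ j.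
  have [c hc] := coef_ddiff P j.
  rewrite /f (_ : (fun m => _) = fun m => rc (u m * c.[x m]) * z ^+ j); last first.
    by apply/funext => m; rewrite hc.
  have [? ->] := ctsum_rc (z ^+ j) (@cux c); split=> //.
  rewrite (_ : \int[mu]_t (ddiff P t)`_j = \int[mu]_t c.[t]); last first.
    by apply: eq_Rintegral => t _; rewrite hc.
  rewrite (sums_at_Rintegral hmu)//; exact: measurable_poly.
have [cs es] := ctsum_sum (index_enum 'I_(size P)) (fun j => (hf j).1).
rewrite (_ : (fun m => rc (u m) * _) = fun m => \sum_j f j m).
  split=> //; rewrite es; apply: eq_bigr => j _; rewrite coef_poly ltn_ord.
  by rewrite (hf j).2.
apply/funext => m; rewrite ceval_ddiff mulfK; last first.
  by rewrite subr_eq0 eq_sym.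
rewrite (ceval_wide z (size_ddiff P (x m))) mulr_sumr.
by apply: eq_bigr => j _; rewrite /f rmorphM mulrA.
Qed.

(** The integral of P(x) / (x - z). *)
Definition rsum P z : R[i] :=
  ctsum (fun m => rc (u m * P.[x m]) * (rc (x m) - z)^-1).

(** With Q of the second kind and S the Stieltjes transform, it equals
    Q(z) + P(z) S(z), for every z at a positive distance from the support, in
    particular for z = 0 when the points are 1, 1/q, 1/q^2 and so on. *)
Lemma rsumE P z (K : R) : (forall m, rc (x m) != z) ->
  (forall m, normc ((rc (x m) - z)^-1) <= K) ->
  rsum P z = ceval (second_kind mu P) z
    + ceval P z * ctsum (fun m => rc (u m) * (rc (x m) - z)^-1).
Proof.
move=> xz xK; have [c1 ->] := ceval_second_kind P xz.
have c2 := cabscv_bounded cu xK.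
rewrite -ctsumZ// -ctsumD//; last exact: cabscvZ.
rewrite /rsum; congr ctsum; apply/funext => m.
have h1 : rc (x m) - z != 0 by rewrite subr_eq0.
rewrite rmorphM /= -[z - rc (x m)]opprB invrN.
by move: (rc (u m)) (rc P.[x m]) ((rc (x m) - z)^-1) => U V Y; ring.
Qed.

End SumsAt.

(** * Orthonormal q-Charlier polynomials: norms and bounds *)

(** Weights of the normalized measure. *)
Definition nweight (R : realType) (q a : R) (m : nat) : R :=
  (euler q (- a))^-1 * qcharlier_weight a q m.

(** The normalized q-Charlier measure. *)
Definition qcharlier_prob (R : realType) (q a : R) (hq : 0 < q < 1) (ha : 0 < a) :
    probability (measurableTypeR R) R :=
  mnormalize (qcharlier_measure hq ha) (dirac (0 : measurableTypeR R)).

Section Bounds.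
Variables (R : realType) (q a : R).
Hypotheses (hq : 0 < q < 1) (ha : 0 < a).
Local Notation rc := (real_complex R).
Local Notation normc := (@Normc.normc R).
Local Notation C := (qcharlier a q).
Local Notation M := (euler q (- a)).
Local Notation W := (nweight q a).
Local Notation mu := (qcharlier_prob hq ha).
Local Notation p := (Defs.orthonormal mu C).
Local Notation rho := (Num.sqrt q).
Implicit Types (z : R[i]).

Let q0 : 0 < q. Proof. by case/andP: hq. Qed.
Let M0 : 0 < M. Proof. exact: mass_gt0. Qed.

Lemma nweight_gt0 m : 0 < W m.
Proof. by rewrite mulr_gt0 ?invr_gt0// qcharlier_weight_gt0. Qed.

Lemma rapid_nweight (g : R -> R) : tame q a g -> rapid (fun m => W m * g (q ^- m)).
Proof.
move=> hg; apply: rapid_ext (rapidZ M^-1 hg) => m; exact: esym (mulrA _ _ _).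
Qed.

Lemma abscv_nweight (g : R -> R) : tame q a g ->
  abscv (fun m => W m * g (q ^- m)).
Proof. by move=> hg; exact/rapid_abscv/rapid_nweight. Qed.

Lemma tsum_nweight (g : R -> R) : tame q a g ->
  tsum (fun m => W m * g (q ^- m)) = M^-1 * qsum q a g.
Proof.
move=> hg; rewrite /qsum -tsumZ; last exact: rapid_abscv.
by congr tsum; apply/funext => m; rewrite mulrA.
Qed.

Lemma qcharlier_prob_sums_at : sums_at mu W (fun m => q ^- m).
Proof.
have h := qcharlier_measure_sums_at hq ha.
have := mnormalize_sums_at (dirac (0 : measurableTypeR R)) h.
by rewrite tsum_weight//; apply.
Qed.

Lemma abscv_nweight_poly (P : {poly R}) : abscv (fun m => W m * P.[q ^- m]).
Proof. by apply: abscv_nweight; exact: tame_poly. Qed.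

Lemma Rintegral_qcharlier_prob (P : {poly R}) :
  \int[mu]_y P.[y] = tsum (fun m => W m * P.[q ^- m]).
Proof.
apply: (sums_at_Rintegral qcharlier_prob_sums_at).
  exact: measurable_poly.
exact: abscv_nweight_poly.
Qed.

Lemma tsum_qcharlier n m :
  tsum (fun k => W k * ((C n).[q ^- k] * (C m).[q ^- k]))
  = qnorm2 q a n * (n == m)%:R.
Proof.
have t : tame q a (fun x => (C n).[x] * (C m).[x]).
  by apply: tame_ext (tame_poly a hq (C n * C m)) => x; rewrite hornerM.
by rewrite (tsum_nweight t) qsum_orthogonal// !mulrA mulVf ?mul1r// gt_eqF.
Qed.

Lemma orthonormalE n : p n = (Num.sqrt (qnorm2 q a n))^-1 *: C n.
Proof.
rewrite /Defs.orthonormal; congr ((Num.sqrt _)^-1 *: _).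
rewrite (_ : \int[mu]_x _ = \int[mu]_x (C n * C n).[x]); last first.
  by apply: eq_Rintegral => x _; rewrite hornerM.
rewrite Rintegral_qcharlier_prob.
under eq_fun do rewrite hornerM.
by rewrite tsum_qcharlier eqxx mulr1.
Qed.

Lemma orthonormal_sqr n : tsum (fun k => W k * ((p n).[q ^- k] ^+ 2)) = 1.
Proof.
have h0 := qnorm2_gt0 hq ha n.
transitivity (tsum (fun k => (qnorm2 q a n)^-1 *
    (W k * ((C n).[q ^- k] * (C n).[q ^- k])))).
  congr tsum; apply/funext => k; rewrite orthonormalE hornerZ exprMn exprVn.
  by rewrite sqr_sqrtr ?ltW// mulrCA expr2.
rewrite tsumZ ?tsum_qcharlier ?eqxx ?mulr1 ?mulVf ?gt_eqF//.
by under eq_fun do rewrite -hornerM; exact: abscv_nweight_poly.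
Qed.

Lemma qcharlier0 : C 0 = 1.
Proof.
by rewrite /qcharlier big_ord_recl big_ord0 !qpoch0 expr0 divr1 mulr1 scale1r addr0.
Qed.

Lemma orthonormal_mean n : tsum (fun k => W k * (p n).[q ^- k]) = (n == 0%N)%:R.
Proof.
transitivity (tsum (fun k => (Num.sqrt (qnorm2 q a n))^-1 *
    (W k * ((C n).[q ^- k] * (C 0).[q ^- k])))).
  congr tsum; apply/funext => k.
  by rewrite orthonormalE hornerZ qcharlier0 -[1]/(1%:P) hornerC mulr1 mulrCA.
rewrite tsumZ; last by under eq_fun do rewrite -hornerM; exact: abscv_nweight_poly.
rewrite tsum_qcharlier; case: eqP => [->|_]; last by rewrite !mulr0.
by rewrite /qnorm2 !qpoch0 expr0 invr1 !mulr1 sqrtr1 invr1.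
Qed.

Lemma orthonormal0 : p 0 = 1.
Proof.
rewrite orthonormalE qcharlier0 /qnorm2 !qpoch0 expr0 invr1 !mulr1.
by rewrite sqrtr1 invr1 scale1r.
Qed.

(** The squared norms grow at least like q^-n. *)
Lemma sqrt_qnorm2_le n :
  (Num.sqrt (qnorm2 q a n))^-1 <= (Num.sqrt (euler q q))^-1 * rho ^+ n.
Proof.
have E0 := euler_q_gt0 hq.
have r0 : 0 < rho by rewrite sqrtr_gt0.
have h0 := qnorm2_gt0 hq ha n.
rewrite -[leRHS]invrK invfM invrK lef_pV2 ?posrE ?sqrtr_gt0//; last first.
  by rewrite mulr_gt0 ?sqrtr_gt0// invr_gt0 exprn_gt0.
have -> : rho ^- n = Num.sqrt (q ^- n).
  rewrite -[LHS]ger0_norm ?invr_ge0 ?exprn_ge0 ?(ltW r0)// -sqrtr_sqr.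
  by congr Num.sqrt; rewrite exprVn exprAC sqr_sqrtr ?ltW.
rewrite -sqrtrM ?(ltW E0)// ler_wsqrtr// /qnorm2 mulrC -mulrA.
rewrite ler_wpM2l ?invr_ge0 ?exprn_ge0 ?(ltW q0)//.
apply: le_trans (euler_le_qpoch hq n) _; rewrite ler_peMl//.
  exact/ltW/qpoch_qq_gt0.
by rewrite qpochN_ge1// divr_ge0 ?ltW.
Qed.

Lemma normc_qpoch z k : normc (qpoch z (rc q) k) <= qpoch (- normc z) q k.
Proof.
elim: k => [|k IH]; first by rewrite !qpoch0 normcR normr1.
rewrite !qpochS Normc.normcM ler_pM ?normc_ge0//.
rewrite mulNr opprK; apply: le_trans (le_normcD 1 _) _.
rewrite (normcR 1) normr1 lerD2l.
rewrite normcN Normc.normcM -rmorphXn normcR ger0_norm//.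
by rewrite exprn_ge0 ?(ltW q0).
Qed.

Lemma ceval_qpochX z k : ceval (qpoch 'X q%:P k) z = qpoch z (rc q) k.
Proof.
rewrite /ceval /qpoch rmorph_prod horner_prod; apply: eq_bigr => i _.
rewrite rmorphB rmorph1 rmorphM /= map_polyX -polyC_exp map_polyC /= rmorphXn.
by rewrite !hornerE.
Qed.

Lemma normc_sum n (u : nat -> R[i]) :
  normc (\sum_(k < n) u k) <= \sum_(k < n) normc (u k).
Proof.
elim/big_ind2: _ => [|x1 x2 y1 y2 h1 h2|k _]; last by [].
  by rewrite (normcR 0) normr0.
by apply: le_trans (le_normcD _ _) _; rewrite lerD.
Qed.

Lemma qcharlier_coef_le n k : (k <= n)%N ->
  `|qpoch (q ^- n) q k / qpoch q q k * (- (q ^+ n.+1 / a)) ^+ k|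
    <= eterm q (- (q / a)) k.
Proof.
move=> kn.
have h j : (j <= n)%N -> `|qpoch (q ^- n) q j| * (q ^+ n) ^+ j <= q ^+ 'C(j, 2).
  elim: j => [|j IH] jn; first by rewrite qpoch0 normr1 !expr0 mulr1.
  rewrite qpochS normrM exprSr binS2 exprD mulrACA ler_pM ?mulr_ge0 ?exprn_ge0 ?(ltW q0)//.
    by apply: IH; exact: ltnW.
  rewrite -[X in _ * X]ger0_norm ?exprn_ge0 ?(ltW q0)// -normrM mulrBl mul1r.
  rewrite mulrAC mulVf ?mul1r ?expf_neq0 ?gt_eqF//.
  rewrite distrC ger0_norm; first by rewrite gerBl exprn_ge0 ?(ltW q0).
  by rewrite subr_ge0 ler_wiXn2l ?(ltW q0) ?(ltnW jn)//; case/andP: hq => _ /ltW.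
rewrite /eterm opprK normrM normrX normrN normrM normfV.
rewrite (gtr0_norm (qpoch_qq_gt0 hq k)).
rewrite (@ger0_norm _ (q ^+ n.+1 / a)) ?divr_ge0 ?exprn_ge0 ?(ltW q0) ?(ltW ha)//.
have -> : q ^+ n.+1 / a = q ^+ n * (q / a) by rewrite exprSr mulrA.
rewrite exprMn mulrAC mulrA ler_wpM2r ?invr_ge0 ?(ltW (qpoch_qq_gt0 hq k))//.
rewrite [leRHS]mulrC ler_wpM2r ?h//.
by rewrite exprn_ge0 ?divr_ge0 ?(ltW q0) ?(ltW ha).
Qed.

Lemma normc_qcharlier n z :
  normc (ceval (C n) z) <= euler q (- (q / a)) * euler q (- normc z).
Proof.
have qa0 : 0 <= q / a by rewrite divr_ge0 ?ltW.
pose f k := qpoch (q ^- n) q k / qpoch q q k * (- (q ^+ n.+1 / a)) ^+ k.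
have -> : ceval (C n) z = \sum_(k < n.+1) rc (f k) * qpoch z (rc q) k.
  rewrite /ceval /qcharlier rmorph_sum horner_sum; apply: eq_bigr => k _.
  by rewrite -/(ceval _ _) cevalZ ceval_qpochX.
apply: le_trans (@normc_sum _ (fun k => rc (f k) * qpoch z (rc q) k)) _.
apply: (@le_trans _ _ (\sum_(k < n.+1)
    eterm q (- (q / a)) k * euler q (- normc z))).
  apply: ler_sum => k _; rewrite Normc.normcM normcR ler_pM ?normc_ge0//.
    by apply: qcharlier_coef_le; rewrite -ltnS.
  apply: le_trans (normc_qpoch z k) _.
  by rewrite qpochN_le ?normc_ge0.
rewrite -mulr_suml ler_wpM2r//.
  by apply: le_trans ler01 _; rewrite euler_ge1 ?normc_ge0.
have t0 k : 0 <= eterm q (- (q / a)) k.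
  by rewrite /eterm opprK divr_ge0 ?mulr_ge0 ?exprn_ge0 ?(ltW q0)// ltW// qpoch_qq_gt0.
rewrite -(big_mkord xpredT (eterm q (- (q / a)))).
by apply: ler_series_tsum => //; exact: abscv_eterm.
Qed.

Lemma normc_orthonormal z : exists2 K : R, 0 <= K &
  forall n, normc (ceval (p n) z) <= K * rho ^+ n.
Proof.
set E := euler q (- (q / a)) * euler q (- normc z).
have E0 : 0 <= E.
  rewrite mulr_ge0//; apply: le_trans ler01 _; rewrite euler_ge1 ?normc_ge0//.
  by rewrite divr_ge0 ?ltW.
exists (E * (Num.sqrt (euler q q))^-1).
  by rewrite mulr_ge0// invr_ge0 sqrtr_ge0.
move=> n; rewrite orthonormalE cevalZ Normc.normcM normcR.
rewrite ger0_norm ?invr_ge0 ?sqrtr_ge0// mulrC -mulrA ler_pM ?normc_ge0//.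
- exact: normc_qcharlier.
- exact: sqrt_qnorm2_le.
Qed.

Lemma nweight_pole m : rc (q ^- m) != 0.
Proof.
apply/eqP => /complexI/eqP; rewrite invr_eq0 expf_eq0 gt_eqF//.
by rewrite andbF.
Qed.

(** The value at 0, from the integrals of C_n(x) / x and of 1 / x. *)
Lemma ceval_second_kind0 n : ceval (second_kind mu (p n)) 0 =
  rc ((Num.sqrt (qnorm2 q a n))^-1 / (1 + a)
        * (qpoch q q n - qpoch (- (q / a)) q n)).
Proof.
have ti : tame q a (fun x => x^-1) by exact: tame_inv.
have ci : abscv (fun m => W m * (q ^- m)^-1) := abscv_nweight ti.
have Si : tsum (fun m => W m * (q ^- m)^-1) = (1 + a)^-1.
  by rewrite (tsum_nweight ti) qsum_inv// mulrA mulVf ?mul1r ?gt_eqF.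
have xK m : normc ((rc (q ^- m) - 0)^-1) <= 1.
  rewrite subr0 Normc.normcV normcR ger0_norm ?invr_ge0 ?exprn_ge0 ?(ltW q0)//.
  rewrite invrK.
  exact: qexp_le1.
have h := rsumE qcharlier_prob_sums_at abscv_nweight_poly (p n) nweight_pole xK.
have -> : ceval (second_kind mu (p n)) 0 =
    rsum W (fun m => q ^- m) (p n) 0 - ceval (p n) 0 *
    ctsum (fun m => rc (W m) * (rc (q ^- m) - 0)^-1) by rewrite h addrK.
have e1 : ctsum (fun m => rc (W m) * (rc (q ^- m) - 0)^-1) = rc (1 + a)^-1.
  have [_] := ctsum_rc 1 ci; rewrite mulr1 Si => <-; congr ctsum.
  by apply/funext => m; rewrite subr0 mulr1 -fmorphV -rmorphM.
have tC : tame q a (fun x => (C n).[x] * x^-1).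
  by apply: tame_ext (tameM_poly (C n) ti) => x; rewrite mulrC.
have e2 : rsum W (fun m => q ^- m) (p n) 0 =
    rc ((Num.sqrt (qnorm2 q a n))^-1 * (qpoch q q n / (1 + a))).
  have [_] := ctsum_rc 1 (@abscvZ _ (Num.sqrt (qnorm2 q a n))^-1 _ (abscv_nweight tC)).
  rewrite mulr1 tsumZ ?(tsum_nweight tC) ?qsum_qcharlier_inv//; last first.
    exact: (abscv_nweight tC).
  have -> : M^-1 * (qpoch q q n * (M / (1 + a))) = qpoch q q n / (1 + a).
    by rewrite mulrCA [M^-1 * _]mulrA mulVf ?gt_eqF// mul1r.
  move=> <-.
  rewrite /rsum; congr ctsum; apply/funext => m.
  rewrite subr0 mulr1 orthonormalE hornerZ -fmorphV -rmorphM; congr rc.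
  by move: (W m) (Num.sqrt _)^-1 ((q ^- m)^-1) => A B D; ring.
rewrite e1 e2 (_ : 0 = rc 0)// cevalR orthonormalE hornerZ qcharlier_at0//.
by rewrite -rmorphM -rmorphB; congr rc; move: (1 + a)^-1 => D; ring.
Qed.

Lemma second_kind_at0 : exists2 K : R, 0 <= K & forall n,
  `|(second_kind mu (p n)).[0]| <= K * rho ^+ n.
Proof.
set E := euler q (- (q / a)).
have qa0 : 0 <= q / a by rewrite divr_ge0 ?ltW.
have E1 : 1 <= E by exact: euler_ge1.
exists ((Num.sqrt (euler q q))^-1 * (1 + E)).
  by rewrite mulr_ge0 ?invr_ge0 ?sqrtr_ge0// addr_ge0// (le_trans ler01).
move=> n.
have -> : (second_kind mu (p n)).[0] = (Num.sqrt (qnorm2 q a n))^-1 / (1 + a)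
        * (qpoch q q n - qpoch (- (q / a)) q n).
  by apply: complexI; rewrite -cevalR ceval_second_kind0.
have a1 : 1 <= 1 + a by rewrite lerDl ltW.
have a0 : 0 < 1 + a by apply: lt_le_trans a1.
have qq1 : qpoch q q n <= 1.
  elim: n => [|n IH]; first by rewrite qpoch0.
  rewrite qpochS (le_trans _ IH)// ler_piMr ?(ltW (qpoch_qq_gt0 hq _))//.
  by rewrite gerBl mulr_ge0 ?exprn_ge0 ?(ltW q0).
have qa1 := @qpochN_ge1 _ _ hq _ n qa0.
rewrite -mulrA mulrAC normrM; apply: ler_pM => //.
  rewrite ger0_norm ?invr_ge0 ?sqrtr_ge0//; exact: sqrt_qnorm2_le.
rewrite normrM normfV (gtr0_norm a0) mulrC ler_pdivrMr//.
apply: (@le_trans _ _ (1 + E)); last first.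
  by rewrite ler_peMr// addr_ge0// (le_trans ler01).
apply: le_trans (ler_normB _ _) _; rewrite lerD//.
  by rewrite ger0_norm// ltW// qpoch_qq_gt0.
by rewrite ger0_norm ?(le_trans ler01)//; exact: qpochN_le.
Qed.

End Bounds.

(** * The q-Charlier measure is not extremal *)

Section Tannery.
Variable R : realType.

Lemma tsum_split (u : nat -> R) L : abscv u ->
  abscv (fun n => u (n + L)%N) /\ tsum u = series u L + tsum (fun n => u (n + L)%N).
Proof.
move=> cu; elim: L => [|L [cL IH]].
  rewrite (_ : (fun n => _) = u); last by apply/funext => n; rewrite addn0.
  by split=> //; rewrite /series /= big_geq// add0r.
rewrite (_ : (fun n => u (n + L.+1)%N) = fun n => u (n.+1 + L)%N); last first.
  by apply/funext => n; rewrite addSnnS.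
split; first exact: (abscv_shift cL).
by rewrite IH (tsumS cL) /series /= big_nat_recr//= addrA.
Qed.

(** Tannery's theorem: dominated convergence for series, with a geometric
    dominating sequence. *)
Lemma tannery (e : nat -> nat -> R) (C : R) :
  (forall N m, `|e N m| <= C * (2^-1) ^+ m) ->
  (forall m, e ^~ m @ \oo --> (0 : R)) ->
  (fun N => tsum (e N)) @ \oo --> (0 : R).
Proof.
move=> eC e0.
have h2 : 0 <= (2^-1 : R) < 1 by rewrite invr_ge0 ler0n invf_lt1 ?ltr1n.
have cg := @abscv_geometric R C 2^-1 h2.
have ce N : abscv (e N) by apply: abscv_le (eC N) cg.
apply/cvgrPdist_le => eps eps0.
have e20 : 0 < eps / 2 by rewrite divr_gt0.
have [L hL] : exists L, tsum (fun n => C * (2^-1) ^+ (n + L)%N) <= eps / 2.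
  have h : (fun L => tsum (fun n => C * 2^-1 ^+ n) * (2^-1) ^+ L) @ \oo -->
      (tsum (fun n => C * 2^-1 ^+ n) * 0 : R).
    apply: cvgMl_tmp; apply: cvg_expr; rewrite ger0_norm; by case/andP: h2.
  rewrite mulr0 in h; move/cvgrPdist_le : h => /(_ _ e20)[L _ /(_ L (leqnn L))].
  rewrite /= sub0r normrN => hL; exists L; apply: le_trans _ hL.
  rewrite mulrC -tsumZ// (le_trans _ (ler_norm _))//.
  rewrite le_eqVlt; apply/orP; left; apply/eqP; congr tsum; apply/funext => n.
  by rewrite exprD; ring.
have hs : (fun N => series (e N) L) @ \oo --> (0 : R).
  elim: (L) => [|L' IH].
    rewrite (_ : (fun N => _) = cst 0); first exact: cvg_cst.
    by apply/funext => N; rewrite /series /= big_geq.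
  rewrite (_ : (fun N => _) = fun N => series (e N) L' + e N L').
    by rewrite -[X in _ --> X]addr0; exact: cvgD.
  by apply/funext => N; rewrite /series /= big_nat_recr.
move/cvgrPdist_le : hs => /(_ _ e20); apply: filterS => N.
rewrite !sub0r !normrN => hN; have [cL ->] := @tsum_split (e N) L (ce N).
apply: le_trans (ler_normD _ _) _; rewrite [leRHS]splitr lerD//.
apply: le_trans _ hL; apply: ler_norm_tsum; first by move=> n; exact: eC.
exact: (@tsum_split _ L cg).1.
Qed.

End Tannery.

Section Extremal.
Variables (R : realType) (q a : R).
Hypotheses (hq : 0 < q < 1) (ha : 0 < a).
Local Notation rc := (real_complex R).
Local Notation re := (@complex.Re R).
Local Notation im := (@complex.Im R).
Local Notation normc := (@Normc.normc R).
Local Notation C := (qcharlier a q).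
Local Notation W := (nweight q a).
Local Notation X := (fun m : nat => q ^- m).
Local Notation mu := (qcharlier_prob hq ha).
Local Notation p := (Defs.orthonormal mu C).
Local Notation Q k := (second_kind mu (p k)).
Local Notation rho := (Num.sqrt q).
Local Notation Ip k z := (rsum W X (p k) z).
Local Notation St z := (ctsum (fun m => rc (W m) * (rc (X m) - z)^-1)).
Implicit Types (z : R[i]).

Let q0 : 0 < q. Proof. by case/andP: hq. Qed.
Let q1 : q < 1. Proof. by case/andP: hq. Qed.
Let W0 m : 0 <= W m. Proof. exact/ltW/nweight_gt0. Qed.
Let cW : abscv W. Proof. by case: (qcharlier_prob_sums_at hq ha). Qed.
Let cWp (P : {poly R}) : abscv (fun m => W m * P.[X m]).
Proof. exact: abscv_nweight_poly. Qed.

Let rho01 : 0 <= rho < 1.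
Proof. by rewrite sqrtr_ge0 -[X in _ < X]sqrtr1 ltr_sqrt. Qed.

Lemma tsum_nweight1 : tsum W = 1.
Proof.
have := orthonormal_mean hq ha 0; rewrite orthonormal0 eqxx mulr1n => <-.
by congr tsum; apply/funext => k; rewrite -[1]/(1%:P) hornerC mulr1.
Qed.

Let cW2 (r n : nat) : abscv (fun m => W m * (X m ^+ r * `|(p n).[X m]|)).
Proof.
apply: abscv_le (abscv_abs (@cWp ('X^r * p n))) => m.
rewrite normrM [leRHS]normrM ler_wpM2l// hornerM hornerXn !normrM normr_id.
by [].
Qed.

(** The bound is uniform in the degree, by x y <= x^2 + y^2. *)
Lemma moment_orthonormal_le r : exists2 B, 0 <= B &
  forall n, tsum (fun m => W m * (X m ^+ r * `|(p n).[X m]|)) <= B.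
Proof.
have c1 := @cWp ('X^(2 * r)).
have c2 n := @cWp (p n * p n).
exists (tsum (fun m => W m * ('X^(2 * r)).[X m]) + 1).
  rewrite addr_ge0// tsum_ge0// => m; rewrite mulr_ge0//.
  by rewrite hornerXn exprn_ge0 ?invr_ge0 ?exprn_ge0 ?(ltW q0).
move=> n; rewrite -(orthonormal_sqr hq ha n).
under [X in _ <= _ + tsum X]eq_fun do rewrite expr2 -hornerM.
rewrite -tsumD//; apply: le_tsum => //; first exact: abscvD.
move=> m; rewrite -mulrDr ler_wpM2l// hornerXn hornerM mulnC exprM.
rewrite -[(p n).[_] * _]expr2 -[(p n).[_] ^+ 2]real_normK ?num_real//.
by move: (_ ^+ r) `|_| => A y; nra.
Qed.

Lemma normc_rsum_le z : im z != 0 ->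
  exists B, forall k, normc (Ip k z) <= B.
Proof.
move=> z0; have [B _ hB] := moment_orthonormal_le 0.
exists (B / `|im z| + B / `|im z|) => k; apply: le_trans (normc_le _) _.
have cK := @abscvZ R (`|im z|^-1) _ (@cW2 0 k).
have bnd (f : R[i] -> R) : (forall y, `|f y| <= normc y) ->
    `|tsum (f \o (fun m => rc (W m * (p k).[X m]) * (rc (X m) - z)^-1))| <= B / `|im z|.
  move=> hf; rewrite mulrC.
  apply: (@le_trans _ _ (tsum (fun m => `|im z|^-1 * (W m * (X m ^+ 0 * `|(p k).[X m]|))))).
    apply: ler_norm_tsum => // m; rewrite expr0 mul1r.
    apply: le_trans (hf _) _; rewrite Normc.normcM normcR mulrC.
    rewrite normrM (ger0_norm (W0 m)) ler_wpM2r ?(mulr_ge0 (W0 m))//.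
    exact: normc_resolvent.
  by rewrite tsumZ// ler_wpM2l ?invr_ge0.
by rewrite lerD//; apply: bnd => y; [exact: normc_ge_re|exact: normc_ge_im].
Qed.

Section Combination.
Variables s t : R.

(** Coefficients of the series of orthonormal polynomials that the value of the
    parameter singles out. *)
Let v k := t * (Q k).[0] - s * (p k).[0].

(** Its partial sums. *)
Let u N : {poly R} := \sum_(k < N) v k *: p k.

Lemma abscv_combination : abscv v.
Proof.
have [K K0 hK] := second_kind_at0 hq ha.
have [L L0 hL] := normc_orthonormal hq ha 0.
apply: (@abscv_le _ _ (fun k => (`|t| * K + `|s| * L) * rho ^+ k)); last first.
  exact: abscv_geometric.
move=> k; apply: le_trans (ler_normB _ _) _; rewrite mulrDl !normrM -!mulrA.
rewrite lerD// ler_wpM2l//.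
by have := hL k; rewrite (_ : 0 = rc 0)// cevalR normcR.
Qed.

Lemma combination0 : v 0 = - s.
Proof.
have : rc (Q 0).[0] = 0.
  by rewrite -cevalR ceval_second_kind0 !qpoch0 subrr mulr0.
move=> /complexI; rewrite /v orthonormal0 => ->.
by rewrite -[1]/(1%:P) hornerC mulr0 sub0r mulr1.
Qed.

Let horner_u N x : (u N).[x] = \sum_(k < N) v k * (p k).[x].
Proof. by rewrite /u horner_sum; apply: eq_bigr => k _; rewrite hornerZ. Qed.

Lemma combination_mean N : tsum (fun m => W m * (u N.+1).[X m]) = - s.
Proof.
transitivity (tsum (fun m => \sum_(k < N.+1) v k * (W m * (p k).[X m]))).
  congr tsum; apply/funext => m; rewrite horner_u mulr_sumr.
  by apply: eq_bigr => k _; rewrite mulrCA.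
rewrite (@tsum_sum _ _ _ (fun (k : 'I_N.+1) m => v k * (W m * (p k).[X m]))).
  rewrite big_ord_recl big1 ?addr0 => [|i _]; rewrite tsumZ ?orthonormal_mean//.
    by rewrite mulr1 combination0.
  by rewrite mulr0.
by move=> k; apply: abscvZ.
Qed.

(** The weighted L^1 norms of the partial sums are bounded. *)
Lemma moment_combination_le r : exists2 B, 0 <= B &
  forall N, abscv (fun m => W m * (X m ^+ r * `|(u N).[X m]|)) /\
    tsum (fun m => W m * (X m ^+ r * `|(u N).[X m]|)) <= B.
Proof.
have [B B0 hB] := moment_orthonormal_le r.
have cv := abscv_combination; have cv' := abscv_abs cv.
exists (tsum (fun k => `|v k|) * B).
  by rewrite mulr_ge0// tsum_ge0.
move=> N.
pose f (k : 'I_N) m := `|v k| * (W m * (X m ^+ r * `|(p k).[X m]|)).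
have cf k : abscv (f k) by apply: abscvZ; exact: cW2.
have Xr m : 0 <= X m ^+ r by rewrite exprn_ge0 ?invr_ge0 ?exprn_ge0 ?(ltW q0).
have le m : `|W m * (X m ^+ r * `|(u N).[X m]|)| <= \sum_k f k m.
  rewrite ger0_norm; last by rewrite mulr_ge0// mulr_ge0.
  under eq_bigr do rewrite /f mulrCA (mulrCA `|v _|).
  rewrite -mulr_sumr ler_wpM2l// -mulr_sumr ler_wpM2l// horner_u.
  apply: le_trans (ler_norm_sum _ _ _) _; apply: ler_sum => k _.
  by rewrite normrM.
have csf := @abscv_sum _ _ (index_enum 'I_N) _ cf.
have cu : abscv (fun m => W m * (X m ^+ r * `|(u N).[X m]|)).
  exact: abscv_le le csf.
split=> //.
apply: (@le_trans _ _ (\sum_(k < N) `|v k| * B)).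
  apply: (@le_trans _ _ (tsum (fun m => \sum_k f k m))).
    by apply: le_tsum => // m; apply: le_trans (ler_norm _) (le m).
  rewrite tsum_sum//; apply: ler_sum => k _.
  by rewrite tsumZ ?ler_wpM2l//; exact: cW2.
rewrite -mulr_suml ler_wpM2r// -(big_mkord xpredT (fun k => `|v k|)).
by apply: ler_series_tsum.
Qed.

(** Masses that tend to 0 exactly when [u N] tends to [t / x] on the support. *)
Let d N m := W m * (X m * (u N).[X m] - t).

Let dE N m : d N m = W m * ('X * u N - t%:P).[X m].
Proof. by rewrite /d hornerD hornerM hornerN hornerC hornerX. Qed.

Let cd N : abscv (d N).
Proof. by rewrite (funext (dE N)); exact: cWp. Qed.

(** Stieltjes transform of the measure of masses [d N m]. *)
Lemma resolvent_combination N z : im z != 0 ->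
  ctsum (fun m => rc (d N.+1 m) * (rc (X m) - z)^-1) =
  z * (\sum_(k < N.+1) rc (v k) * Ip k z) - (rc s + rc t * St z).
Proof.
move=> z0.
have rK m := normc_resolvent (X m) z0.
have cR r : abscv r -> cabscv (fun m => rc (r m) * (rc (X m) - z)^-1).
  by move=> cr; exact: cabscv_bounded cr rK.
have [c1 e1] := ctsum_rc 1 (@cWp (u N.+1)).
rewrite combination_mean mulr1 in e1.
have eI : ctsum (fun m => rc (W m * (u N.+1).[X m]) * (rc (X m) - z)^-1) =
    \sum_(k < N.+1) rc (v k) * Ip k z.
  pose f (k : 'I_N.+1) m := rc (v k) * (rc (W m * (p k).[X m]) * (rc (X m) - z)^-1).
  have cf k : cabscv (f k) by apply: cabscvZ; apply: cR; exact: cWp.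
  have [_ h] := ctsum_sum (index_enum 'I_N.+1) cf.
  transitivity (ctsum (fun m => \sum_k f k m)).
    congr ctsum; apply/funext => m; rewrite horner_u mulr_sumr rmorph_sum mulr_suml.
    by apply: eq_bigr => k _; rewrite mulrCA [in LHS]rmorphM -[LHS]mulrA.
  rewrite h; apply: eq_bigr => k _; rewrite /f ctsumZ//.
  by apply: cR; exact: cWp.
have c2 := cR _ (@cWp (u N.+1)); have c3 := cR _ cW.
have cz2 := cabscvZ z c2; have ct3 := cabscvZ (- rc t) c3.
transitivity (ctsum (fun m => rc (W m * (u N.+1).[X m]) * 1 +
    (z * (rc (W m * (u N.+1).[X m]) * (rc (X m) - z)^-1) +
     - rc t * (rc (W m) * (rc (X m) - z)^-1)))).
  congr ctsum; apply/funext => m; rewrite /d.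
  have h1 := subRc_neq0 (X m) z0.
  have rcM x y : rc (x * y) = rc x * rc y by exact: rmorphM.
  have rcB x y : rc (x - y) = rc x - rc y by exact: rmorphB.
  move: (W m) ((u N.+1).[X m]) => V U; rewrite !(rcM, rcB).
  have -> : rc (X m) = (rc (X m) - z) + z by rewrite subrK.
  move: (rc (X m) - z) (rc V) (rc U) (rc t) h1 => Y V' U' t' h1.
  by rewrite addrK; field.
rewrite ctsumD//; last exact: cabscvD.
by rewrite ctsumD// !ctsumZ// eI e1 rmorphN; ring.
Qed.

(** The equation that the parametrization imposes. *)
Hypothesis key : forall z, im z != 0 ->
  z * ctsum (fun k => rc (v k) * Ip k z) = rc s + rc t * St z.

Lemma im_resolvent_combination z : im z != 0 ->
  (fun N => tsum (fun m => d N m * im ((rc (X m) - z)^-1))) @ \oo --> (0 : R).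
Proof.
move=> z0.
have [B hB] := normc_rsum_le z0.
have [/abscv_cvg cr /abscv_cvg ci] := cabscv_bounded abscv_combination hB.
have := key z0; set T := ctsum _ => hT.
rewrite -(cvg_shiftS (fun N => tsum _)) /=.
have e N : tsum (fun m => d N.+1 m * im ((rc (X m) - z)^-1)) =
    re z * (series (im \o (fun k => rc (v k) * Ip k z)) N.+1 - im T)
    + im z * (series (re \o (fun k => rc (v k) * Ip k z)) N.+1 - re T).
  transitivity (im (ctsum (fun m => rc (d N.+1 m) * (rc (X m) - z)^-1))).
    by congr tsum; apply/funext => m /=; rewrite -ImZ.
  rewrite resolvent_combination// -hT -mulrBr ImM.
  have ReN y : re (- y) = - re y by case: y.
  have ImN y : im (- y) = - im y by case: y.
  rewrite ReD ImD ReN ImN /series /= !big_mkord.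
  by rewrite (big_morph re (@ReD R) (erefl _)) (big_morph im (@ImD R) (erefl _)).
have aux (c l : R) (w : nat -> R) : w @ \oo --> l ->
    (fun N => c * (w N.+1 - l)) @ \oo --> (0 : R).
  rewrite -(cvg_shiftS w) => hw.
  have h : (fun N => w N.+1 - l) @ \oo --> (l - l : R).
    by apply: cvgB hw _; exact: cvg_cst.
  by rewrite -(mulr0 c) -(subrr l); exact: cvgMl_tmp.
rewrite (funext e).
have := cvgD (aux (re z) _ _ ci) (aux (im z) _ _ cr); rewrite addr0.
exact.
Qed.

(** Distinct points of the support are at distance at least 1/q - 1. *)
Lemma support_gap m n : m != n -> q^-1 - 1 <= `|X m - X n|.
Proof.
wlog mn : m n / (m < n)%N => [hw|] ne.
  have [/hw/(_ ne)//|] := ltnP m n; rewrite leq_eqVlt eq_sym (negPf ne) /= => nm.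
  by rewrite distrC; apply: hw => //; rewrite eq_sym.
rewrite distrC; apply: le_trans (ler_norm _).
have q1' : 1 <= q^-1 by rewrite invf_ge1 ?(ltW q1).
rewrite -!exprVn -(subnK mn) addnS -addSn exprD exprS.
have h1 : 1 <= q^-1 ^+ (n - m.+1) by exact: exprn_ege1.
have h2 : 1 <= q^-1 ^+ m by exact: exprn_ege1.
move: (q^-1) (_ ^+ (n - m.+1)) (_ ^+ m) q1' h1 h2 => g A B g1 A1 B1.
have h3 : 0 <= (A - 1) * g by rewrite mulr_ge0; lra.
have h4 : 0 <= (B - 1) * (A * g - 1) by rewrite mulr_ge0; lra.
by lra.
Qed.

(** At height y above a point of the support, y times the imaginary part of the
    Stieltjes transform is the mass of that point, up to an error of order
    y^2 uniform in N since the support has gaps and the total variations are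
    bounded. *)
Lemma cvg_masses m : d ^~ m @ \oo --> (0 : R).
Proof.
have [B B0 hB] := moment_combination_le 1.
pose K := B + `|t|; have K0 : 0 <= K by rewrite addr_ge0.
have hK N : tsum (fun m => `|d N m|) <= K.
  have [c1 h1] := hB N; rewrite /K -[`|t|]mulr1 -tsum_nweight1 -tsumZ//.
  have ct := @abscvZ _ `|t| _ cW.
  apply: (@le_trans _ _ (tsum (fun m => W m * (X m ^+ 1 * `|(u N).[X m]|) + `|t| * W m))).
    apply: le_tsum; [exact: abscv_abs|exact: abscvD|move=> n].
    rewrite normrM (ger0_norm (W0 n)) [`|t| * _]mulrC -mulrDr ler_wpM2l//.
    apply: le_trans (ler_normB _ _) _; rewrite lerD2r normrM expr1.
    by rewrite ger0_norm ?invr_ge0 ?exprn_ge0 ?(ltW q0).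
  by rewrite tsumD// lerD2r.
pose g := q^-1 - 1; have g0 : 0 < g by rewrite subr_gt0 invf_gt1.
apply/cvgrPdist_le => eps eps0.
have e20 : 0 < eps / 2 by rewrite divr_gt0.
(* The height [y] at which the other masses contribute at most [eps / 2]. *)
have [y y0 hy] : exists2 y : R, 0 < y & y ^+ 2 * (K / g ^+ 2) <= eps / 2.
  pose A := K / g ^+ 2.
  have A0 : 0 <= A by rewrite divr_ge0// sqr_ge0.
  exists (Num.sqrt (eps / 2 / (A + 1))).
    by rewrite sqrtr_gt0 divr_gt0// ltr_wpDl.
  rewrite sqr_sqrtr; last by rewrite divr_ge0 ?(ltW e20)// addr_ge0.
  rewrite -/A mulrAC ler_pdivrMr ?ltr_wpDl// ler_wpM2l ?(ltW e20)//.
  by rewrite lerDl.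
pose z := Complex (X m) y.
have z0 : im z != 0 by rewrite /z /= gt_eqF.
have hy0 : (fun N => y * tsum (fun n => d N n * im ((rc (X n) - z)^-1)))
    @ \oo --> (y * 0 : R).
  by apply: cvgMl_tmp; exact: im_resolvent_combination.
rewrite mulr0 in hy0.
move/cvgrPdist_le : hy0 => /(_ _ e20); apply: filterS => N.
rewrite !sub0r !normrN.
pose k n := y * im ((rc (X n) - z)^-1).
have kE n : k n = y ^+ 2 / ((X n - X m) ^+ 2 + y ^+ 2).
  by rewrite /k im_resolvent /z /= mulrA expr2.
have km : k m = 1 by rewrite kE subrr expr0n /= add0r divff// gt_eqF// exprn_gt0.
have kn n : n != m -> 0 <= k n <= y ^+ 2 / g ^+ 2.
  move=> nm; have den : g ^+ 2 <= (X n - X m) ^+ 2 + y ^+ 2.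
    apply: (@le_trans _ _ ((X n - X m) ^+ 2)); last by rewrite lerDl sqr_ge0.
    rewrite -[leRHS]real_normK ?num_real// lerXn2r ?nnegrE ?(ltW g0)//.
    exact: support_gap.
  have gg : 0 < g ^+ 2 by rewrite exprn_gt0.
  have den0 := lt_le_trans gg den.
  rewrite kE divr_ge0 ?sqr_ge0 ?(ltW den0)//=.
  by rewrite ler_wpM2l ?sqr_ge0// lef_pV2.
have k01 n : 0 <= k n <= 1.
  rewrite kE; have den0 : 0 < (X n - X m) ^+ 2 + y ^+ 2.
    by rewrite ltr_wpDl ?sqr_ge0// exprn_gt0.
  rewrite divr_ge0 ?sqr_ge0 ?(ltW den0)//= ler_pdivrMr// mul1r.
  by rewrite lerDr sqr_ge0.
have cdk : abscv (fun n => d N n * k n).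
  apply: abscv_le (abscv_abs (@cd N)) => n; rewrite normrM.
  have /andP[h1 h2] := k01 n; rewrite (ger0_norm h1).
  by rewrite ler_piMr.
have cdi : abscv (fun n => d N n * im ((rc (X n) - z)^-1)).
  have := @abscvZ _ y^-1 _ cdk; rewrite (_ : (fun n => _) = fun n =>
    d N n * im ((rc (X n) - z)^-1))//.
  by apply/funext => n; rewrite /k mulrCA mulKf// gt_eqF.
rewrite -tsumZ//; under [in X in X -> _]eq_fun do rewrite mulrCA -/(k _).
rewrite (tsumD1 m cdk) km mulr1.
set T := tsum _ => hN.
have hT : `|T| <= y ^+ 2 / g ^+ 2 * K.
  have yg : 0 <= y ^+ 2 / g ^+ 2 by rewrite divr_ge0 ?sqr_ge0.
  apply: (@le_trans _ _ (tsum (fun n => y ^+ 2 / g ^+ 2 * `|d N n|))).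
    apply: ler_norm_tsum; last by apply: abscvZ; exact: abscv_abs.
    move=> n; case: ifPn => [_|nm]; first by rewrite normr0 mulr_ge0.
    have /andP[h1 h2] := kn n nm; rewrite normrM mulrC (ger0_norm h1).
    by rewrite ler_wpM2r.
  by rewrite tsumZ ?ler_wpM2l//; exact: abscv_abs.
rewrite -[d N m](addrK T); apply: le_trans (ler_normB _ _) _.
rewrite [leRHS]splitr lerD//; apply: le_trans hT _.
by apply: le_trans hy; rewrite mulrAC mulrA.
Qed.

(** Integration of a function of geometric growth commutes with the limit. *)
Lemma cvg_integrals (f : nat -> R) F b : 0 <= b ->
  (forall m, `|f m| <= F * b ^+ m) ->
  (fun N => tsum (fun m => W m * f m * (u N).[X m]) -
            t * tsum (fun m => W m * f m * (X m)^-1)) @ \oo --> (0 : R).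
Proof.
move=> b0 fF.
have F0 : 0 <= F by have := fF 0%N; rewrite expr0 mulr1; exact: le_trans.
have X1 m : 1 <= X m.
  by rewrite -exprVn exprn_ege1// invf_ge1 ?(ltW q1).
have rWp (P : {poly R}) : rapid (fun m => W m * P.[X m]).
  by apply: rapid_nweight; exact: tame_poly.
have rWi : rapid (fun m => W m * (X m)^-1).
  by apply: rapid_nweight; exact: tame_inv.
have cu N : abscv (fun m => W m * f m * (u N).[X m]).
  apply: rapid_abscv; apply: rapid_ext (rapidM fF b0 (rWp (u N))) => m.
  by rewrite mulrAC.
have ci : abscv (fun m => W m * f m * (X m)^-1).
  apply: rapid_abscv; apply: rapid_ext (rapidM fF b0 rWi) => m.
  by rewrite mulrAC.
have e N : tsum (fun m => W m * f m * (u N).[X m]) -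
      t * tsum (fun m => W m * f m * (X m)^-1)
    = tsum (fun m => f m * (X m)^-1 * d N m).
  rewrite -tsumZ// -tsumB//; last exact: abscvZ.
  congr tsum; apply/funext => m; rewrite /d.
  have : X m != 0 by rewrite gt_eqF// (lt_le_trans ltr01).
  by move: (W m) (X m) => V x x0; field.
rewrite (funext e).
(* The order of the moment that beats the growth of [f]. *)
have [r hr] : exists r, b * q ^+ r <= 2^-1.
  have : (fun r => b * q ^+ r) @ \oo --> (b * 0 : R).
    by apply: cvgMl_tmp; apply: cvg_expr; rewrite ger0_norm// ltW.
  have h2 : 0 < (2^-1 : R) by rewrite invr_gt0.
  rewrite mulr0 => /cvgrPdist_le /(_ _ h2)[r _ /(_ r (leqnn r))] /=.
  by rewrite sub0r normrN => h; exists r; apply: le_trans (ler_norm _) h.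
have [B B0 hB] := moment_combination_le r.+1.
pose S := tsum (fun m => W m * ('X^r).[X m]).
have hd N m : `|d N m| <= (B + `|t| * S) * (q ^+ r) ^+ m.
  have Xr : 0 <= X m ^+ r by rewrite exprn_ge0// (le_trans ler01).
  have e1 : (q ^+ r) ^+ m * X m ^+ r = 1.
    by rewrite exprAC -exprMn divff ?expr1n// expf_neq0// gt_eqF.
  have q0m : 0 <= (q ^+ r) ^+ m by rewrite !exprn_ge0// ltW.
  have -> : `|d N m| = `|d N m| * X m ^+ r * (q ^+ r) ^+ m.
    by rewrite -mulrA [X m ^+ r * _]mulrC e1 mulr1.
  rewrite ler_wpM2r// /d normrM (ger0_norm (W0 m)).
  apply: (@le_trans _ _ (W m * (X m ^+ r.+1 * `|(u N).[X m]|)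
                         + `|t| * (W m * X m ^+ r))).
    have := ler_normB (X m * (u N).[X m]) t; rewrite normrM.
    rewrite [`|X m|]ger0_norm ?(le_trans ler01)// => h.
    apply: (@le_trans _ _ (W m * (X m * `|(u N).[X m]| + `|t|) * X m ^+ r)).
      by rewrite ler_wpM2r// ler_wpM2l.
    rewrite exprS le_eqVlt; apply/orP; left; apply/eqP.
    by move: (W m) (X m) (X m ^+ r) `|_| => V x y w; ring.
  have [c1 h1] := hB N; rewrite lerD//.
    apply: le_trans h1; apply: (ler_tsum_term m c1) => n.
    by rewrite mulr_ge0// mulr_ge0// exprn_ge0// (le_trans ler01).
  rewrite ler_wpM2l// -hornerXn; apply: (ler_tsum_term m (@cWp ('X^r))) => n.
  by rewrite mulr_ge0// hornerXn exprn_ge0// (le_trans ler01).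
have S0 : 0 <= B + `|t| * S.
  rewrite addr_ge0// mulr_ge0// tsum_ge0// => n.
  by rewrite mulr_ge0// hornerXn exprn_ge0// (le_trans ler01).
apply: (@tannery _ _ (F * (B + `|t| * S))) => [N m|m].
  rewrite normrM normrM.
  apply: (@le_trans _ _ ((F * b ^+ m * 1) * ((B + `|t| * S) * (q ^+ r) ^+ m))).
    apply: ler_pM => //; apply: ler_pM => //; rewrite normfV ger0_norm ?(le_trans ler01)//.
    by rewrite invf_le1 ?(lt_le_trans ltr01).
  rewrite mulr1 mulrACA -exprMn ler_wpM2l ?mulr_ge0//.
  by rewrite lerXn2r ?nnegrE ?mulr_ge0 ?invr_ge0 ?exprn_ge0// ltW.
by rewrite -(mulr0 (f m * (X m)^-1)); apply: cvgMl_tmp; exact: cvg_masses.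
Qed.

(** The terms of the expansion of E(1) annihilate all polynomials. *)
Let eterm_null (P : {poly R}) : tsum (fun m => eterm q 1 m * P.[X m]) = 0.
Proof.
have e i m : eterm q 1 m * X m ^+ i = eterm q (q ^- i) m.
  by rewrite -[q ^- i in RHS]mul1r eterm_scale exprVAC.
pose f (i : 'I_(size P)) m := P`_i * eterm q (q ^- i) m.
have cf i : abscv (f i) by apply: abscvZ; exact: abscv_eterm.
transitivity (tsum (fun m => \sum_i f i m)).
  congr tsum; apply/funext => m; rewrite horner_coef mulr_sumr.
  by apply: eq_bigr => i _; rewrite /f -e mulrCA.
rewrite tsum_sum// big1// => i _.
rewrite tsumZ; last exact: abscv_eterm.
by rewrite -[tsum _]/(euler q (q ^- i)) euler_pole ?mulr0.
Qed.

Lemma combination_trivial : t = 0 /\ s = 0.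
Proof.
have M0 : 0 < euler q (- a) by exact: mass_gt0.
have a0 : a != 0 by rewrite gt_eqF.
have cst0 (l : R) : (fun _ : nat => l) @ \oo --> (0 : R) -> l = 0.
  by move=> /(cvg_lim (@Rhausdorff R)); rewrite lim_cst.
have t0 : t = 0.
  (* The function (- 1/a)^m is orthogonal to all polynomials, but not to 1/x. *)
  have fb m : `|(- a^-1) ^+ m| <= 1 * a^-1 ^+ m.
    by rewrite mul1r normrX normrN ger0_norm ?invr_ge0 ?(ltW ha).
  have ia : 0 <= a^-1 by rewrite invr_ge0 ltW.
  have We m : W m * (- a^-1) ^+ m = (euler q (- a))^-1 * eterm q 1 m.
    rewrite /nweight /qcharlier_weight /eterm -[- a^-1]mulN1r exprMn exprVn.
    have : a ^+ m != 0 by rewrite expf_neq0.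
    move: (euler q (- a))^-1 (qpoch q q m)^-1 (a ^+ m) => U V A hA.
    by field.
  have := cvg_integrals ia fb.
  rewrite (_ : (fun N => _) = fun=> - t * ((euler q (- a))^-1 * euler q q)).
    move=> /cst0/eqP; rewrite mulf_eq0 oppr_eq0 => /orP[/eqP//|].
    by rewrite mulf_eq0 invr_eq0 !gt_eqF// euler_q_gt0.
  apply/funext => N.
  rewrite (_ : tsum (fun m => W m * _ * (u N).[_]) = 0); last first.
    transitivity (tsum (fun m => (euler q (- a))^-1 * (eterm q 1 m * (u N).[X m]))).
      by congr tsum; apply/funext => m; rewrite We -[LHS]mulrA.
    rewrite tsumZ ?eterm_null ?mulr0//.
    apply: rapid_abscv.
    have h := @rapidM R (fun m => W m * (u N).[X m]) _ 1 a^-1 fb ia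
      (rapid_nweight (tame_poly a hq (u N))).
    apply: rapid_ext (rapidZ (euler q (- a)) h) => m.
    by rewrite [W m * _ * _]mulrAC We -(mulrA (euler q (- a))^-1) mulVKf// gt_eqF.
  rewrite sub0r mulNr; congr (- (t * _)).
  rewrite /euler -tsumZ; last exact: abscv_eterm.
  congr tsum; apply/funext => m.
  have := eterm_scale q 1 q m; rewrite mul1r => ->.
  by rewrite We -[LHS]mulrA invrK.
split=> //.
have f1 m : `|(1 : R)| <= 1 * 1 ^+ m by rewrite normr1 expr1n mulr1.
have := cvg_integrals ler01 f1; rewrite -cvg_shiftS /=.
rewrite (_ : (fun N => _) = fun=> - s); last first.
  apply/funext => N; rewrite t0 mul0r subr0 -(combination_mean N).
  by congr tsum; apply/funext => m; rewrite mulr1.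
by move=> /cst0/eqP; rewrite oppr_eq0 => /eqP.
Qed.

End Combination.
End Extremal.

Lemma moebius_combination (K : comPzRingType) (s t z S a b c d : K) :
  t * (z * a + (-1 + z * b) * S) = s * (1 + z * c + z * d * S) ->
  z * (t * (a + S * b) + - s * (c + S * d)) = s + t * S.
Proof.
move=> h; apply/subr0_eq; transitivity (t * (z * a + (-1 + z * b) * S)
  - s * (1 + z * c + z * d * S)); first by ring.
by rewrite h subrr.
Qed.

Section NotExtremal.
Variables (R : realType) (q a : R).
Hypotheses (hq : 0 < q < 1) (ha : 0 < a).
Local Notation rc := (real_complex R).
Local Notation im := (@complex.Im R).
Local Notation normc := (@Normc.normc R).
Local Notation C := (qcharlier a q).
Local Notation W := (nweight q a).
Local Notation X := (fun m : nat => q ^- m).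
Local Notation mu := (qcharlier_prob hq ha).
Local Notation p := (Defs.orthonormal mu C).
Local Notation Q k := (second_kind mu (p k)).
Local Notation Ip k z := (rsum W X (p k) z).
Local Notation St z := (ctsum (fun m => rc (W m) * (rc (X m) - z)^-1)).
Local Notation T f g z := (ctsum (fun k => rc (f k).[0] * ceval (g k) z)).
Implicit Types (z : R[i]).

Let hmu : sums_at mu W X := qcharlier_prob_sums_at hq ha.

Let rho01 : 0 <= Num.sqrt q < 1.
Proof. by rewrite sqrtr_ge0 -[X in _ < X]sqrtr1 ltr_sqrt; case/andP: hq. Qed.

Let abscv_p0 : abscv (fun k => (p k).[0]).
Proof.
have [K K0 hK] := normc_orthonormal hq ha 0.
apply: abscv_le (@abscv_geometric _ K _ rho01) => k.
by have := hK k; rewrite (_ : 0 = rc 0)// cevalR normcR.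
Qed.

Let abscv_Q0 : abscv (fun k => (Q k).[0]).
Proof.
have [K K0 hK] := second_kind_at0 hq ha.
exact: abscv_le hK (@abscv_geometric _ K _ rho01).
Qed.

Lemma rsum_orthonormalE z k : im z != 0 ->
  Ip k z = ceval (Q k) z + ceval (p k) z * St z.
Proof.
move=> z0; apply: (@rsumE _ _ _ _ hmu _ (p k) z (`|im z|^-1)) => [P|m|m].
- exact: abscv_nweight_poly.
- by rewrite -subr_eq0 subRc_neq0.
- exact: normc_resolvent.
Qed.

Lemma ceval_orthonormal_bounded z :
  exists B, forall k, normc (ceval (p k) z) <= B.
Proof.
have [K K0 hK] := normc_orthonormal hq ha z.
exists K => k; apply: le_trans (hK k) _.
by rewrite ler_piMr// exprn_ile1//; case/andP: rho01 => // _ /ltW.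
Qed.

Lemma ceval_second_kind_bounded z : im z != 0 ->
  exists B, forall k, normc (ceval (Q k) z) <= B.
Proof.
move=> z0; have [B hB] := ceval_orthonormal_bounded z.
have [D hD] := normc_rsum_le hq ha z0.
exists (D + B * normc (St z)) => k.
have -> : ceval (Q k) z = Ip k z + - (ceval (p k) z * St z).
  by rewrite rsum_orthonormalE// addrK.
apply: le_trans (le_normcD _ _) _; rewrite normcN Normc.normcM lerD//.
by rewrite ler_wpM2r// normc_ge0.
Qed.

(** The series in the entries of the Nevanlinna matrix converge absolutely. *)
Lemma nevanlinna_entry (f g : nat -> {poly R}) z B :
  abscv (fun k => (f k).[0]) -> (forall k, normc (ceval (g k) z) <= B) ->
  cabscv (fun k => rc (f k).[0] * ceval (g k) z) /\
  kernel0 f g z = z * T f g z.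
Proof.
move=> cf gB; have cc := cabscv_bounded cf gB; split=> //.
rewrite /kernel0 -csumE//; congr (_ * csum _); apply/funext => k.
by rewrite -cevalR.
Qed.

(** The imaginary part of this sum has the sign of that of [z]. *)
Lemma stieltjes_neq0 z : im z != 0 -> St z != 0.
Proof.
move=> z0; have [[_ ci] _] := stieltjes_sums_at hmu z0.
pose g m := W m / ((X m - complex.Re z) ^+ 2 + im z ^+ 2).
have eg : im \o (fun m => rc (W m) * (rc (X m) - z)^-1) = fun m => im z * g m.
  by apply/funext => m /=; rewrite ImZ im_resolvent mulrCA.
have cg : abscv g.
  rewrite (_ : g = fun m => (im z)^-1 * (im z * g m)).
    by apply: abscvZ; rewrite -eg.
  by apply/funext => m; rewrite mulKf.
have g0 m : 0 < g m by rewrite divr_gt0 ?nweight_gt0 ?resolvent_den_gt0.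
apply/eqP => /(congr1 im) /=; rewrite eg tsumZ// => /eqP.
rewrite mulf_eq0 (negPf z0) /= => /eqP g00.
have := @ler_tsum_term _ _ 0%N cg (fun m => ltW (g0 m)).
by rewrite g00 leNgt g0.
Qed.

(** Parameter t corresponds to s = 1, and parameter oo to s = 0 and t = 1. *)
Lemma nevanlinna_combination z (s t : R) : im z != 0 ->
  rc t * (nevanlinnaA mu C z + nevanlinnaB mu C z * St z) =
    rc s * (nevanlinnaC mu C z + nevanlinnaD mu C z * St z) ->
  z * ctsum (fun k => rc (t * (Q k).[0] - s * (p k).[0]) * Ip k z) =
  rc s + rc t * St z.
Proof.
move=> z0.
have [B hB] := ceval_orthonormal_bounded z.
have [D hD] := ceval_second_kind_bounded z0.
have [cQQ eA] := nevanlinna_entry abscv_Q0 hD.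
have [cQp eB] := nevanlinna_entry abscv_Q0 hB.
have [cpQ eC] := nevanlinna_entry abscv_p0 hD.
have [cpp eD] := nevanlinna_entry abscv_p0 hB.
rewrite /nevanlinnaA /nevanlinnaB /nevanlinnaC /nevanlinnaD eA eB eC eD.
have -> : ctsum (fun k => rc (t * (Q k).[0] - s * (p k).[0]) * Ip k z) =
    rc t * (T (fun k => Q k) (fun k => Q k) z + St z * T (fun k => Q k) p z) +
    - rc s * (T p (fun k => Q k) z + St z * T p p z).
  have sQp := cabscvZ (St z) cQp; have spp := cabscvZ (St z) cpp.
  have c1 := cabscvD cQQ sQp; have c2 := cabscvD cpQ spp.
  rewrite -!ctsumZ// -!ctsumD// -!ctsumZ// -ctsumD//; [|exact: cabscvZ..].
  congr ctsum; apply/funext => k; rewrite rsum_orthonormalE//.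
  have rcM x y : rc (x * y) = rc x * rc y by exact: rmorphM.
  have rcB x y : rc (x - y) = rc x - rc y by exact: rmorphB.
  by rewrite rcB !rcM; ring.
exact: moebius_combination.
Qed.

(** A zero denominator in the parametrization would make the Stieltjes transform
    vanish, which it never does off the real line. *)
Lemma qcharlier_not_extremal : ~ extremal C mu.
Proof.
have trivial (s t : R) : (forall z, im z != 0 ->
    rc t * (nevanlinnaA mu C z + nevanlinnaB mu C z * St z) =
    rc s * (nevanlinnaC mu C z + nevanlinnaD mu C z * St z)) -> t = 0 /\ s = 0.
  move=> h; apply: (combination_trivial (hq := hq) (ha := ha)) => z z0.
  by apply: nevanlinna_combination => //; exact: h.
case=> [h|[t h]].
  have [|] := trivial 0 1; last by move=> /eqP; rewrite oner_eq0.
  move=> z z0; have := h z z0; have [_ ->] := stieltjes_sums_at hmu z0.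
  have := stieltjes_neq0 z0; set S := St z => S0 hS; move: S0; rewrite hS.
  have [->|B0 _] := eqVneq (nevanlinnaB mu C z) 0.
    by rewrite invr0 mulr0 oppr0 eqxx.
  rewrite (_ : rc 0 = 0)// mul0r mulrN [nevanlinnaB _ _ _ * _]mulrC divfK//.
  by rewrite subrr mulr0.
have [|_] := trivial 1 t; last by move=> /eqP; rewrite oner_eq0.
move=> z z0; have := h z z0; have [_ ->] := stieltjes_sums_at hmu z0.
have := stieltjes_neq0 z0; set S := St z => S0 hS; move: S0; rewrite hS.
set num := nevanlinnaA mu C z * _ - _; set den := nevanlinnaB mu C z * _ - _.
have [->|B0 _] := eqVneq den 0; first by rewrite invr0 mulr0 oppr0 eqxx.
have e : den * - (num / den) = - num by rewrite mulrN mulrC divfK.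
rewrite (_ : rc 1 = 1)// mul1r; move: e; set y := - _.
rewrite /num /den; move: (nevanlinnaA _ _ _) (nevanlinnaB _ _ _) => A B.
move: (nevanlinnaC _ _ _) (nevanlinnaD _ _ _) => C' D e.
apply/eqP; rewrite -subr_eq0; apply/eqP.
transitivity ((B * rc t - D) * y + (A * rc t - C')); first by ring.
by rewrite e addNr.
Qed.

End NotExtremal.

Theorem mainTheorem8 (R : realType) (q a : R) (hq : 0 < q < 1) (ha : 0 < a) :
  [/\ indeterminate (qcharlier a q),
      forall n n' : nat,
        series (fun m : nat => qcharlier_weight a q m
                  * (qcharlier a q n).[q ^- m] * (qcharlier a q n').[q ^- m])
          @ \oo -->
        qpoch_inf (- a) q * q ^- n * qpoch (- (q / a)) q n * qpoch q q n
          * (n == n')%:R,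
      orthogonal_for (qcharlier a q) (qcharlier_measure hq ha)
    & ~ extremal (qcharlier a q)
          (mnormalize (qcharlier_measure hq ha) (dirac (0 : measurableTypeR R)))].
Proof.
split.
- exact: qcharlier_indeterminate.
- move=> n n'.
  have tn : tame q a (fun x => (qcharlier a q n).[x] * (qcharlier a q n').[x]).
    apply: tame_ext (tame_poly a hq (qcharlier a q n * qcharlier a q n')) => x.
    by rewrite hornerM.
  have e : tsum (fun m => qcharlier_weight a q m *
      ((qcharlier a q n).[q ^- m] * (qcharlier a q n').[q ^- m])) =
      qpoch_inf (- a) q * q ^- n * qpoch (- (q / a)) q n * qpoch q q n
        * (n == n')%:R.
    have := qsum_orthogonal hq ha n n'; rewrite /qsum => ->.
    by rewrite qpoch_infE// /qnorm2 !mulrA.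
  rewrite -e (_ : series _ = series (fun m => qcharlier_weight a q m *
      ((qcharlier a q n).[q ^- m] * (qcharlier a q n').[q ^- m]))).
    exact: abscv_cvg (rapid_abscv tn).
  by congr series; apply/funext => m; rewrite mulrA.
- have h := qcharlier_measure_sums_at hq ha.
  apply: (sums_at_orthogonal_for hq ha h (K := 1)) => //.
    by move=> k; exact: abscv_weight.
  by move=> k; rewrite mul1r.
- exact: qcharlier_not_extremal.
Qed.
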